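(* Let $K$ be a CM field with maximal totally real subfield $K_0$, and suppose the different $\mathcal{D}_{K_0/\mathbf{Q}}$ is principal, generated by $\delta$. For every principally polarized abelian variety $A$ over $\mathbf{C}$ with CM by $\mathcal{O}_K$ there exists $z\in K$ such that $\mathfrak{a}=z\mathcal{O}_{K_0}+\mathcal{O}_{K_0}\subset K$ is an $\mathcal{O}_K$-module and, with $\xi=(z-\overline{z})^{-1}\delta^{-1}$ and $\Phi=\{\phi:K\to\mathbf{C}\mid \mathrm{Im}\,\phi(\xi)>0\}$, we have $A\cong A_{\Phi,\mathfrak{a},\xi}$.
   Context: A CM field of degree $2g$ is a totally imaginary quadratic extension of a totally real field $K_0$ of degree $g$. A CM type is a set $\Phi$ of $g$ embeddings $K\to\mathbf{C}$ with $\Phi\cup\overline\Phi$ all embeddings; $\Phi(\alpha)=(\phi(\alpha))_{\phi\in\Phi}\in\mathbf{C}^g$. For a CM type $\Phi$, fractional $\mathcal{O}_K$-ideal $\mathfrak{a}$, and $\xi$ generating $(\mathfrak{a}\overline{\mathfrak{a}}\mathcal{D}_{K/\mathbf{Q}})^{-1}$ with $\phi(\xi)$ on the positive imaginary axis for $\phi\in\Phi$, $A_{\Phi,\mathfrak{a},\xi}$ denotes $(\mathbf{C}^g/\Phi(\mathfrak{a}),E)$ with $E$ the $\mathbf{R}$-bilinear extension of $E(\Phi(\alpha),\Phi(\beta))=\mathrm{Tr}_{K/\mathbf{Q}}(\xi\alpha\overline\beta)$. CM by $\mathcal{O}_K$ means dimension $g$ and a ring embedding $\mathcal{O}_K\to\mathrm{End}(A)$.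 $\cong$ denotes isomorphism of polarized abelian varieties (a $\mathbf{C}$-linear isomorphism mapping lattice onto lattice and pulling back the polarization to the polarization).
   Formalization: If A is not simple, the embedding of O_K in End(A) is also assumed stable under the Rosati involution; without this the claim fails, e.g. for E×E with product polarization, E=C/Z[i], K=Q(i,√7). Every A for which the claim holds admits such an embedding. *)

(* Defs.v *)
From HB Require Import structures.
From mathcomp Require Import all_boot all_order all_algebra all_field.
From mathcomp Require Import all_classical reals complex.

Set Implicit Arguments.
Unset Strict Implicit.
Unset Printing Implicit Defensive.
Import Order.TTheory GRing.Theory Num.Theory.
Local Open Scope classical_set_scope.
Local Open Scope ring_scope.
Local Open Scope complex_scope.

Section NumberFields.
Variable L : fieldExtType rat.
Implicit Types I J : set L.

Definition ring_of_integers : set L :=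
  [set x | integralOver (intr : int -> L) x].

(* Tr_{L/Q}(x): the trace of multiplication by x, computed in a basis.        *)
Definition field_trace (x : L) : rat :=
  \sum_(i < \dim {:L}) coord (vbasis {:L}) i (x * (vbasis {:L})`_i).

Definition OL_submodule I : Prop :=
  [/\ I 0, forall x y, I x -> I y -> I (x - y)
    & forall r x, ring_of_integers r -> I x -> I (r * x)].

Definition fractional_ideal I : Prop :=
  [/\ OL_submodule I, exists2 x, I x & x != 0
    & exists2 d : L, d != 0 & forall x, I x -> ring_of_integers (d * x)].

Definition principal_ideal (x : L) : set L :=
  [set x * r | r in ring_of_integers].

Definition ideal_mul I J : set L :=
  [set w | exists n (x y : 'I_n -> L),
     (forall i, I (x i) /\ J (y i)) /\ w = \sum_(i < n) x i * y i].

Definition ideal_inv I : set L :=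
  [set x | forall y, I y -> ring_of_integers (x * y)].

Definition codifferent : set L :=
  [set x | forall y, ring_of_integers y -> field_trace (x * y) \is a Num.int].

Definition different : set L := ideal_inv codifferent.

End NumberFields.

Arguments ring_of_integers L : clear implicits.
Arguments codifferent L : clear implicits.
Arguments different L : clear implicits.

Section CMFields.
Variables (R : realType) (K : fieldExtType rat).

Definition totally_real (L : fieldExtType rat) : Prop :=
  forall (phi : {rmorphism L -> R[i]}) (x : L), complex.Im (phi x) = 0.

Definition totally_imaginary (L : fieldExtType rat) : Prop :=
  forall phi : {rmorphism L -> R[i]}, exists x : L, complex.Im (phi x) != 0.

(* A totally real K0 with [K : K0] = 2 is necessarily the largest totally     *)
(* real subfield of the totally imaginary field K.                            *)
Definition CM_field (g : nat) (K0 : {subfield K}) : Prop :=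
  [/\ \dim K0 = g, \dim {:K} = (2 * g)%N,
      totally_real (subvs_of K0) & totally_imaginary K].

(* For a CM field K, the unique y with phi(y) = conj(phi(x)) for every        *)
(* embedding phi of K; the default value x is never used there.               *)
Definition cmconj (x : K) : K :=
  xget x [set y | forall phi : {rmorphism K -> R[i]}, phi y = conjc (phi x)].

Definition embeddings : set (K -> R[i]) :=
  [set f : K -> R[i] | exists phi : {rmorphism K -> R[i]}, f = phi].

Definition CM_type (g : nat) (Phi : set (K -> R[i])) : Prop :=
  (Phi #= [set: 'I_g])%card /\
  Phi `|` [set (fun x => conjc (f x)) | f in Phi] = embeddings.

Definition CM_triple (g : nat) (Phi : set (K -> R[i])) (a : set K) (xi : K) :
    Prop :=
  [/\ CM_type g Phi, fractional_ideal a,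
      ideal_inv (ideal_mul (ideal_mul a (cmconj @` a)) (different K))
        = principal_ideal xi
    & forall f, Phi f -> complex.Re (f xi) = 0 /\ 0 < complex.Im (f xi)].

End CMFields.

Arguments embeddings R K : clear implicits.

Section AbelianVarieties.
Variables (R : realType) (g : nat).
Local Notation V := 'cV[R[i]]_g.

Definition lattice_basis (n : nat) (b : 'I_n -> V) (Lam : set V) : Prop :=
  (forall t : 'I_n -> R, \sum_i (t i)%:C *: b i = 0 -> forall i, t i = 0) /\
  Lam = [set v | exists m : 'I_n -> int, v = \sum_i (m i)%:~R *: b i].

(* A polarized abelian variety C^g / lat, with the polarization given by its  *)
(* Riemann form E.  The sign convention, E(u, iu) > 0, is the one satisfied   *)
(* by E(Phi(x), Phi(y)) = Tr(xi * x * conj(y)) when Im phi(xi) > 0.           *)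
Record polAV := PolAV {
  lat : set V;
  rform : V -> V -> R;
  lat_lattice : exists b : 'I_(2 * g) -> V, lattice_basis b lat;
  form_linear : forall (t : R) (u v w : V),
    rform (t%:C *: u + v) w = t * rform u w + rform v w;
  form_skew : forall u v : V, rform v u = - rform u v;
  form_int : forall u v : V, lat u -> lat v -> rform u v \is a Num.int;
  form_i : forall u v : V, rform ('i%C *: u) ('i%C *: v) = rform u v;
  form_pos : forall u : V, u != 0 -> 0 < rform u ('i%C *: u) }.

Definition principally_polarized (A : polAV) : Prop :=
  exists2 b : 'I_(2 * g) -> V, lattice_basis b (lat A) &
    \det (\matrix_(i, j) rform A (b i) (b j)) = 1.

(* Endomorphisms of the complex torus; they need not respect E.               *)
Definition AV_end (A : polAV) : set 'M[R[i]]_g :=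
  [set M | forall v, lat A v -> lat A (M *m v)].

Definition polAV_iso (A B : polAV) : Prop :=
  exists M : 'M[R[i]]_g,
    [/\ M \in unitmx, [set M *m v | v in lat A] = lat B
      & forall u v, rform B (M *m u) (M *m v) = rform A u v].

Definition complex_subspace (W : set V) : Prop :=
  W 0 /\ forall (t : R[i]) u v, W u -> W v -> W (t *: u + v).

(* W is the tangent space of an abelian subvariety: W is spanned over R by    *)
(* its lattice points.                                                        *)
Definition subtorus (A : polAV) (W : set V) : Prop :=
  complex_subspace W /\
  forall w, W w -> exists n (t : 'I_n -> R) (l : 'I_n -> V),
    (forall i, W (l i) /\ lat A (l i)) /\ w = \sum_(i < n) (t i)%:C *: l i.

Definition simple_AV (A : polAV) : Prop :=
  (0 < g)%N /\
  forall W, subtorus A W -> W = [set 0] \/ W = setT.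

Section ComplexMultiplication.
Variable K : fieldExtType rat.
Local Notation OK := (ring_of_integers K).

(* A ring embedding O_K -> End(A); the values of iota outside O_K are         *)
(* irrelevant.                                                                *)
Definition CM_embedding (A : polAV) (iota : K -> 'M[R[i]]_g) : Prop :=
  [/\ forall x, OK x -> AV_end A (iota x),
      iota 1 = 1%:M,
      forall x y, OK x -> OK y -> iota (x + y) = iota x + iota y,
      forall x y, OK x -> OK y -> iota (x * y) = iota x *m iota y
    & forall x y, OK x -> OK y -> iota x = iota y -> x = y].

(* iota(O_K) is stable under the Rosati involution of the polarization.  This *)
(* is automatic when A is simple, but fails in general: for E = C/Z[i] with   *)
(* its product polarization on E^2, and K = Q(i, sqrt 7), O_K embeds in       *)
(* End(E^2) = M_2(Z[i]), yet no embedding is stable, since 7 is not a sum of  *)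
(* three squares.                                                             *)
Definition rosati_stable (A : polAV) (iota : K -> 'M[R[i]]_g) : Prop :=
  forall x, OK x -> exists2 y, OK y &
    forall u v, rform A (iota x *m u) v = rform A u (iota y *m v).

Definition Phi_vec (phi : 'I_g -> K -> R[i]) (x : K) : V := \col_i phi i x.

(* B is A_{Phi,a,xi} in the coordinates of C^g given by an enumeration phi of *)
(* Phi.  Since rform B is R-bilinear and Phi(a) spans C^g over R, the last    *)
(* condition makes rform B the R-bilinear extension of the trace form.        *)
Definition is_A_Phi_a_xi (Phi : set (K -> R[i])) (a : set K) (xi : K)
    (B : polAV) : Prop :=
  exists phi : 'I_g -> K -> R[i],
    [/\ set_bij setT Phi phi, lat B = Phi_vec phi @` a
      & forall x y : K, rform B (Phi_vec phi x) (Phi_vec phi y)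
          = ratr (field_trace (xi * x * cmconj R y))].

End ComplexMultiplication.
End AbelianVarieties.

(* Main.v *)
Require Import Defs.
From HB Require Import structures.
From mathcomp Require Import all_boot all_order all_algebra all_field.
From mathcomp Require Import all_classical reals complex.
From mathcomp Require Import ring lra zify.
Set Implicit Arguments.
Unset Strict Implicit.
Unset Printing Implicit Defensive.
Import Order.TTheory GRing.Theory Num.Theory.
Local Open Scope classical_set_scope.
Local Open Scope ring_scope.

(** Let J extend the CM action to K and let v0 be a nonzero lattice vector.
    Counting dimensions, the rational span of the lattice is J(K) v0, so the
    lattice is J(I) v0 for a fractional ideal I.  Diagonalizing J, with v0 going
    to (1,...,1), turns J(x) v0 into Phi(x).  The adjoint of J(x) for the Riemann
    form lies in J(K): for simple A, its difference with the element of J(K)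
    that agrees with it on v0 has a nonzero kernel, which is a subtorus.
    Testing on eigenvectors, the adjoint is complex conjugation, whence
    E(Phi x, Phi y) = Tr(xi x ybar).

    Since the different of K0 is (delta), B(u,v) = delta xi (u vbar - ubar v) is
    a perfect alternating O_{K0}-form on I, a lattice of rank 2.  Such a lattice
    has a basis x, y with B(x,y) = 1, and z = x/y is the required element.
    Instead of prime factorization, everything local is done in the finite
    rings O/N with idempotents: if P is a set of values closed under gluing along
    idempotents, then either 1 lies in P modulo N or some s, nonzero modulo N,
    kills P.  This is applied to products in C C^-1, to {B(x,y)} and to
    {B(y + t x1, m)}. *)

(** * Finite quotients and idempotents *)

Section Orders.
Variable F : fieldType.
Implicit Types (O P C : set F) (N x y : F).

(** An O_{K0}-lattice of rank 2 need not be free, so freeness of I has to come from the form. The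
    Gram determinant 1 makes I equal to its own dual for Tr(xi x ybar). As bar xi = -xi, this trace
    is the trace from K0 of xi (u vbar - ubar v), and multiplication by delta moves the values from
    the codifferent of K0 into O_{K0}; hence B is perfect. The obstacle is that the set of values of
    B is not known in advance to be closed under addition, so the value 1 is reached by gluing
    arguments of B along idempotents rather than by adding values. An s that kills every value
    modulo N is excluded because s/N then maps I into its dual, which is I, and so is integral. Once
    B(x,y) = 1, dividing I by y replaces xi by xi y ybar = ((z - zbar) delta)^-1, and phi(y ybar) =
    |phi(y)|^2 > 0 keeps the CM type. The Rosati step has a second use: the conjugation of K is
    itself obtained from the adjoint. *)

Definition subring O : Prop :=
  [/\ O 1, forall x y, O x -> O y -> O (x - y)
    & forall x y, O x -> O y -> O (x * y)].

(** Instead of a quotient ring, a colouring [k] by finitely many values whose colour classes, within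
    [O], lie in single cosets of N O. *)
Definition finite_quotients O : Prop :=
  forall N, O N -> N != 0 -> exists (T : finType) (k : F -> T),
    forall x y, O x -> O y -> k x = k y -> O (N^-1 * (x - y)).

Definition completely_integrally_closed O : Prop :=
  forall N c, N != 0 -> (forall k, O (N * c ^+ k)) -> O c.

Definition submodule_over O C : Prop :=
  [/\ C 0, forall x y, C x -> C y -> C (x - y)
    & forall r x, O r -> C x -> C (r * x)].

Definition colon O C : set F := [set y | forall c, C c -> O (y * c)].

Variable O : set F.
Hypothesis hO : subring O.

Lemma subring1 : O 1. Proof. by case: hO. Qed.
Lemma subringB x y : O x -> O y -> O (x - y). Proof. by case: hO => _ h _; exact: h. Qed.
Lemma subringM x y : O x -> O y -> O (x * y). Proof. by case: hO => _ _; exact. Qed.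
Lemma subring0 : O 0.
Proof. by rewrite -(subrr 1); apply: subringB; exact: subring1. Qed.
Lemma subringN x : O x -> O (- x).
Proof. by move=> h; rewrite -sub0r; apply: subringB => //; exact: subring0. Qed.
Lemma subringD x y : O x -> O y -> O (x + y).
Proof. by move=> hx hy; rewrite -[y]opprK; apply: subringB => //; exact: subringN. Qed.
Lemma subringX x n : O x -> O (x ^+ n).
Proof.
move=> h; elim: n => [|n ih]; first exact: subring1.
by rewrite exprS; exact: subringM.
Qed.
Lemma subring_nat n : O n%:R.
Proof.
elim: n => [|n ih]; first exact: subring0.
by rewrite -natr1; apply: subringD => //; exact: subring1.
Qed.
Lemma subring_int (n : int) : O n%:~R.
Proof.
case: n => n; first exact: subring_nat.
by rewrite NegzE mulrNz; apply: subringN; exact: subring_nat.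
Qed.

Lemma subring_submodule : submodule_over O O.
Proof. by split; [exact: subring0|exact: subringB|exact: subringM]. Qed.

Lemma submoduleN C x : submodule_over O C -> C x -> C (- x).
Proof. by case=> h0 hB _ hx; rewrite -sub0r; exact: hB. Qed.

Lemma submoduleD C x y : submodule_over O C -> C x -> C y -> C (x + y).
Proof.
move=> hC hx hy; rewrite -[y]opprK; case: (hC) => _ hB _.
by apply: hB => //; exact: submoduleN.
Qed.

Lemma submodule_sum C (I : Type) (s : seq I) (Q : pred I) (f : I -> F) :
  submodule_over O C -> (forall i, C (f i)) -> C (\sum_(i <- s | Q i) f i).
Proof.
by move=> hC hf; case: (hC) => C0 _ _; apply: (big_ind C) => // x y; exact: submoduleD.
Qed.

Lemma subring_sum (I : Type) (s : seq I) (Q : pred I) (f : I -> F) :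
  (forall i, O (f i)) -> O (\sum_(i <- s | Q i) f i).
Proof. exact: (submodule_sum _ _ subring_submodule). Qed.

Section Modulus.
Variable N : F.
Hypothesis N0 : N != 0.

Definition mult x := O (N^-1 * x).

Lemma mult_submodule : submodule_over O mult.
Proof.
split; rewrite /mult; first by rewrite mulr0; exact: subring0.
  by move=> x y hx hy; rewrite mulrBr; exact: subringB.
by move=> r x hr hx; rewrite mulrCA; exact: subringM.
Qed.

Lemma multD x y : mult x -> mult y -> mult (x + y).
Proof. exact: (submoduleD mult_submodule). Qed.
Lemma multB x y : mult x -> mult y -> mult (x - y).
Proof. by case: mult_submodule => _ h _; exact: h. Qed.
Lemma multM x y : mult x -> O y -> mult (x * y).
Proof. by case: mult_submodule => _ _ h hx hy; rewrite mulrC; exact: h. Qed.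
Lemma mult0 : mult 0. Proof. by case: mult_submodule. Qed.

Lemma mult_exprB x y n : O x -> O y -> mult (x - y) -> mult (x ^+ n - y ^+ n).
Proof.
move=> hx hy h; rewrite subrXX; apply: multM => //.
by apply: subring_sum => i; apply: subringM; exact: subringX.
Qed.

Variables (T : finType) (k : F -> T).
Hypothesis hk : forall x y, O x -> O y -> k x = k y -> mult (x - y).

Lemma pigeonhole_mult (f : nat -> F) :
  (forall i, O (f i)) -> exists i j, (i < j)%N /\ mult (f j - f i).
Proof.
move=> hf; pose h (i : 'I_#|T|.+1) := k (f i).
have : ~~ injectiveb h.
  by apply/negP => /injectiveP /leq_card; rewrite card_ord ltnn.
case/injectivePn => i [j ij eqh].
have hne : (i : nat) != j by [].
case: (ltngtP i j) => hij; last by rewrite hij eqxx in hne.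
  by exists i, j; split => //; apply: hk.
by exists j, i; split => //; apply: hk.
Qed.

(** By pigeonhole the powers of x modulo N are periodic with period d = j - i from exponent i on.
    The exponent (i+1)d is beyond i and divisible by d, so doubling it changes nothing. *)
Lemma idempotent_power x : O x ->
  exists n, mult (x ^+ n.+1 * x ^+ n.+1 - x ^+ n.+1).
Proof.
move=> hx; have [i [j [ij hij]]] := pigeonhole_mult (fun i => subringX i hx).
pose d := (j - i)%N; have d0 : (0 < d)%N by rewrite subn_gt0.
have step m c : (i <= m)%N -> mult (x ^+ (m + c * d) - x ^+ m).
  move=> im; elim: c => [|c ih].
    by rewrite mul0n addn0 subrr; exact: mult0.
  have -> : x ^+ (m + c.+1 * d) - x ^+ m =
      (x ^+ j - x ^+ i) * x ^+ (m - i + c * d) + (x ^+ (m + c * d) - x ^+ m).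
    rewrite mulrBl -!exprD.
    have -> : (j + (m - i + c * d) = m + c.+1 * d)%N by rewrite /d; lia.
    have -> : (i + (m - i + c * d) = m + c * d)%N by lia.
    by ring.
  by apply: multD => //; apply: multM => //; exact: subringX.
have e : ((i.+1 * d).-1).+1 = (i.+1 * d)%N by rewrite prednK // muln_gt0.
exists (i.+1 * d).-1; rewrite e -exprD; apply: step.
by apply: leq_trans (leqnSn i) _; rewrite leq_pmulr.
Qed.

Variable P : set F.
Hypothesis PO : P `<=` O.
Hypothesis P0 : P 0.
(** Gluing: the new value is e on the factor of O/N cut out by e and p^(n+1) on the complementary
    factor. Arbitrary powers are allowed because the power that gets glued in is the one that is
    idempotent. *)
Hypothesis Pclosed : forall e p n, P e -> P p -> mult (e * e - e) ->
  exists2 p', P p' & mult (p' - (e + ((1 - e) * p) ^+ n.+1)).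

(** An idempotent power f of (1 - e)p is orthogonal to e, so e + f is again idempotent modulo N. On
    its complement p has become nilpotent, and earlier members of the list stay so because the
    complement has shrunk. *)
Lemma gather_idempotent (l : seq F) : (forall p, p \in l -> P p) ->
  exists e, [/\ P e, mult (e * e - e)
    & forall p, p \in l -> exists n, mult (((1 - e) * p) ^+ n)].
Proof.
elim: l => [_|p l ih hl].
  by exists 0; split=> //; rewrite mulr0 subrr; exact: mult0.
have [|e [Pe ee he]] := ih; first by move=> q hq; apply: hl; rewrite inE hq orbT.
have Pp : P p by apply: hl; rewrite mem_head.
have Oe := PO Pe; have Op := PO Pp.
have O1e : O (1 - e) by apply: subringB => //; exact: subring1.
set s := (1 - e) * p; have Os : O s by exact: subringM.
have [n hn] := idempotent_power Os.
have [e' Pe' he'] := Pclosed n Pe Pp ee.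
rewrite -/s in he'; set f := s ^+ n.+1 in hn he'.
have Of : O f by exact: subringX.
have Oe' := PO Pe'.
have ef : mult (e * f).
  have -> : e * f = (e * e - e) * (- (p * s ^+ n)).
    by rewrite /f exprS {1}/s; ring.
  by apply: multM => //; apply: subringN; apply: subringM => //; exact: subringX.
have O1f : O (1 - f) by apply: subringB => //; exact: subring1.
have O1e' : O (1 - e') by apply: subringB => //; exact: subring1.
(* The complement of e' is the product of the complements of e and f, up to ef, which vanishes
   modulo N; this transfers nilpotency from 1 - e to 1 - e'. *)
have c1 : mult ((1 - e') - (1 - f) * (1 - e)).
  have -> : (1 - e') - (1 - f) * (1 - e) = - (e' - (e + f)) - e * f by ring.
  by apply: multB => //; exact: (submoduleN mult_submodule).
have key q m : O q -> mult (((1 - f) * ((1 - e) * q)) ^+ m) ->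
    mult (((1 - e') * q) ^+ m).
  move=> Oq hm; rewrite -[X in mult X](subrK (((1 - f) * ((1 - e) * q)) ^+ m)).
  apply: multD => //; apply: mult_exprB; try by do !apply: subringM.
  by rewrite mulrA -mulrBl; exact: multM.
exists e'; split=> //.
  have -> : e' * e' - e' = (e' - (e + f)) * (e' + e + f - 1) + ((e * e - e) +
     (f * f - f) + (e * f) * 2%:R) by ring.
  apply: multD; last first.
    by apply: multD; [exact: multD|apply: multM => //; exact: subring_nat].
  by apply: multM => //; apply: subringB; [do !apply: subringD|exact: subring1].
move=> q; rewrite inE => /orP [/eqP ->|ql].
  exists n.+1; apply: key => //; rewrite -/s exprMn -/f.
  have -> : (1 - f) ^+ n.+1 * f = (f * f - f) * (- (1 - f) ^+ n).
    by rewrite exprS; ring.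
  by apply: multM => //; apply: subringN; exact: subringX.
have Oq : O q by apply: PO; apply: hl; rewrite inE ql orbT.
have [m hm] := he q ql; exists m; apply: key => //.
by rewrite exprMn mulrC; apply: multM => //; exact: subringX.
Qed.

(** Start with s = 1 - e and, for each p in turn, multiply s by the highest power of (1 - e)p that
    keeps it nonzero modulo N; one more factor kills it. As se vanishes modulo N, killing (1 - e)p
    is killing p. *)
Lemma kill_nilpotents (l : seq F) e : (forall p, p \in l -> O p) -> O e ->
  mult (e * e - e) -> ~ mult (1 - e) ->
  (forall p, p \in l -> exists n, mult (((1 - e) * p) ^+ n)) ->
  exists s, [/\ O s, ~ mult s, mult (s * e) & forall p, p \in l -> mult (s * p)].
Proof.
move=> hl Oe ee ne; have O1e : O (1 - e) by apply: subringB => //; exact: subring1.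
elim: l hl => [_ _|p l ih hl hn].
  exists (1 - e); split=> //.
  have -> : (1 - e) * e = - (e * e - e) by ring.
  exact: (submoduleN mult_submodule).
have [||s [Os ns se hs]] := ih.
- by move=> q hq; apply: hl; rewrite inE hq orbT.
- by move=> q hq; apply: hn; rewrite inE hq orbT.
have Op : O p by apply: hl; rewrite mem_head.
set t := (1 - e) * p; have Ot : O t by exact: subringM.
have [n hnp] : exists n, mult (t ^+ n) by apply: hn; rewrite mem_head.
have hex : exists n, `[< mult (s * t ^+ n) >].
  by exists n; apply/asboolP; rewrite mulrC; exact: multM.
case: (ex_minnP hex) => -[|m] /asboolP hm hmin.
  by case: ns; rewrite expr0 mulr1 in hm.
exists (s * t ^+ m); have Otm : O (t ^+ m) by exact: subringX.
split; first exact: subringM.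
- by move=> /asboolP /hmin; rewrite ltnn.
- by rewrite mulrAC; exact: multM.
move=> q; rewrite inE => /orP [/eqP ->|ql]; last first.
  by rewrite mulrAC; apply: multM => //; exact: hs.
have -> : s * t ^+ m * p = s * t ^+ m.+1 + s * e * (t ^+ m * p).
  by rewrite exprS /t; ring.
by apply: multD => //; apply: multM => //; exact: subringM.
Qed.

(* In the finite ring O/NO, either P contains a unit idempotent, hence 1, or the
   complement of a maximal idempotent of P is a nonzero factor on which P is nil,
   and this factor contains a nonzero element killed by P. *)
Lemma one_or_annihilator :
  (exists2 e, P e & mult (e - 1)) \/
  exists s, [/\ O s, ~ mult s & forall p, P p -> mult (s * p)].
Proof.
(* One representative in P for each colour. The default 0 lies in P as well, so the finite list [l]
   stays inside P and meets every colour that P takes. *)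
pose r t := xget 0 [set p | P p /\ k p = t].
have rP t : P (r t) by rewrite /r; case: xgetP => // p _ [].
have rk p : P p -> k (r (k p)) = k p.
  by move=> hp; rewrite /r; case: xgetP => [q _ []//|/(_ p)[]].
pose l := [seq r t | t <- enum T].
have lP p : p \in l -> P p by case/mapP => t _ ->.
have [e [Pe ee he]] := gather_idempotent lP.
have Oe := PO Pe.
have [h|h] := pselect (mult (1 - e)).
  left; exists e => //; rewrite -opprB.
  exact: (submoduleN mult_submodule).
have [s [Os ns _ hs]] := kill_nilpotents (fun p hp => PO (lP p hp)) Oe ee h he.
right; exists s; split=> // p hp.
rewrite -[p](subrK (r (k p))) mulrDr; apply: multD.
  rewrite mulrC; apply: multM => //; apply: hk; [exact: PO|exact/PO/rP|].
  by rewrite rk.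
by apply: hs; apply/mapP; exists (k p) => //; rewrite mem_enum.
Qed.

End Modulus.

(** All c^n x stay in C, so N x is a common denominator for all powers of c. *)
Lemma almost_integral_colon C c N :
  completely_integrally_closed O -> submodule_over O C ->
  (exists2 x, C x & x != 0) -> N != 0 -> (forall x, C x -> O (N * x)) ->
  (forall x, C x -> C (c * x)) -> O c.
Proof.
move=> hci hC [x Cx x0] N0 hN hc; apply: (hci (N * x)); first by rewrite mulf_neq0.
move=> n; rewrite -mulrA; apply: hN; elim: n => [|n ih]; first by rewrite mulr1.
by rewrite exprS mulrCA; exact: hc.
Qed.

Lemma colon_submodule C : submodule_over O (colon O C).
Proof.
split=> [c _|x y hx hy c hc|r x hr hx c hc].
- by rewrite mul0r; exact: subring0.
- by rewrite mulrBl; apply: subringB; [exact: hx|exact: hy].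
- by rewrite -mulrA; apply: subringM => //; exact: hx.
Qed.

(** P is the product of C with its inverse. If 1 is not in P modulo M, some s outside M O satisfies
    s P in M O; then s/M maps the inverse of C to itself and is therefore in O, a contradiction. *)
Lemma colon_invertible C N :
  finite_quotients O -> completely_integrally_closed O ->
  submodule_over O C -> (exists2 x, C x & x != 0) ->
  N != 0 -> (forall x, C x -> O (N * x)) ->
  exists s : seq (F * F),
    (forall p, p \in s -> C p.1 /\ colon O C p.2) /\ \sum_(p <- s) p.1 * p.2 = 1.
Proof.
move=> hfin hci hC [x0 Cx0 x00] N0 hN.
pose P : set F := [set w | exists2 s : seq (F * F),
    (forall p, p \in s -> C p.1 /\ colon O C p.2) & \sum_(p <- s) p.1 * p.2 = w].
suff [s hs e] : P 1 by exists s.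
have PD x y : P x -> P y -> P (x + y).
  case=> s hs <- [t ht <-]; exists (s ++ t); last by rewrite big_cat.
  by move=> p; rewrite mem_cat => /orP []; [exact: hs|exact: ht].
have PM r x : O r -> P x -> P (r * x).
  move=> hr [s hs <-]; exists [seq (r * p.1, p.2) | p <- s].
    move=> _ /mapP [p hp ->] /=; have [h1 h2] := hs p hp; split=> //.
    by case: hC => _ _; exact.
  by rewrite big_map mulr_sumr; apply: eq_bigr => p _ /=; rewrite mulrA.
have P1 x y : C x -> colon O C y -> P (x * y).
  move=> hx hy; exists [:: (x, y)]; last by rewrite big_seq1.
  by move=> p; rewrite inE => /eqP ->.
have PO : P `<=` O.
  move=> _ [s hs <-]; rewrite big_seq.
  apply: (big_ind O); [exact: subring0|by move=> *; exact: subringD|].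
  by move=> p hp; have [h1 h2] := hs p hp; rewrite mulrC; exact: h2.
have hP : submodule_over O P.
  split=> [|x y hx hy|r x]; last exact: PM.
    by exists [::]; rewrite ?big_nil.
  apply: PD => //; rewrite -mulN1r; apply: PM => //.
  by apply: subringN; exact: subring1.
(* The modulus is taken inside P, so that 1 in P modulo M gives 1 in P. *)
set M := x0 * N.
have PMm : P M by exact: P1.
have M0 : M != 0 by rewrite mulf_neq0.
have [T [k hk]] := hfin M (PO _ PMm) M0.
have P0 : P 0 by case: hP.
have [|[e Pe he]|[s [Os ns hs]]] := @one_or_annihilator M M0 T k hk P PO P0.
- move=> e p n Pe Pp _; exists (e + ((1 - e) * p) ^+ n.+1); last first.
    by rewrite subrr; exact: mult0.
  apply: PD => //; rewrite exprSr mulrA; apply: PM => //.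
  have O1e : O (1 - e) by apply: subringB; [exact: subring1|exact: PO].
  by apply: subringM => //; apply: subringX; apply: subringM => //; exact: PO.
- have -> : 1 = e - M^-1 * (e - 1) * M by field.
  by case: hP => _ h _; apply: h => //; exact: PM.
case: ns; rewrite /mult; apply: (almost_integral_colon (N := x0) hci (colon_submodule C)).
- by exists N.
- by [].
- by move=> y hy; rewrite mulrC; exact: hy.
move=> y hy c hc; have := hs _ (P1 _ _ hc hy).
by rewrite /mult; congr O; ring.
Qed.

End Orders.

(** * Number fields and traces *)

Lemma lincomb_mulmx (S : pzRingType) (W : lmodType S) (m n p : nat)
    (M : 'M[S]_(m, n)) (N : 'M[S]_(n, p)) (f : 'I_p -> W) j :
  \sum_i M j i *: (\sum_k N i k *: f k) = \sum_k (M *m N) j k *: f k.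
Proof.
under eq_bigr do rewrite scaler_sumr.
rewrite exchange_big /=; apply: eq_bigr => k _.
by rewrite mxE scaler_suml; apply: eq_bigr => i _; rewrite scalerA.
Qed.

Lemma common_denominator (I : finType) (f : I -> rat) :
  exists N : nat, (0 < N)%N /\ exists m : I -> int, forall i, N%:R * f i = (m i)%:~R.
Proof.
pose N := (\prod_i `|denq (f i)|)%N.
exists N; split.
  by rewrite prodn_gt0 // => i; rewrite absz_gt0 denq_neq0.
exists (fun i => numq (f i) * (N %/ `|denq (f i)|)%N%:Z) => i.
have dv : (`|denq (f i)| %| N)%N by rewrite /N (bigD1 i) //= dvdn_mulr.
rewrite -{1}(divnK dv) natrM intrM numqE -mulrA mulrC; congr (_ * _).
by rewrite mulrC -[in RHS](@gtz0_abs (denq (f i))) ?denq_gt0.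
Qed.

Section NumberField.
Variable L : fieldExtType rat.
Local Notation OL := (ring_of_integers L).
Implicit Types x y c : L.

Lemma OL_subring : subring OL.
Proof.
split; first exact: integral1.
  by move=> x y; exact: integral_sub.
by move=> x y; exact: integral_mul.
Qed.

(** The b_i form an eigenvector with eigenvalue c of the transposed matrix, so a monic integral
    characteristic polynomial kills c. *)
Lemma integral_of_int_matrix n (A : 'M[int]_n) (b : 'I_n -> L) c :
  (exists i, b i != 0) -> (forall j, c * b j = \sum_i (A j i)%:~R * b i) -> OL c.
Proof.
move=> [i0 bi0] h.
have hev : root (char_poly (map_mx intr A^T)) c.
  rewrite -eigenvalue_root_char; apply/eigenvalueP.
  exists (\row_i b i); last first.
    by apply/eqP => /rowP /(_ i0); rewrite !mxE; apply/eqP.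
  apply/rowP => j; rewrite !mxE h; apply: eq_bigr => i _.
  by rewrite !mxE mulrC.
rewrite -map_char_poly in hev.
exists (char_poly A^T) => //; exact: char_poly_monic.
Qed.

Lemma clear_denominator x : exists2 N : nat, (0 < N)%N & OL (N%:R * x).
Proof.
pose e := vbasis {:L}.
pose A j i := coord e i (x * e`_j).
have [N [N0 [m hm]]] :=
  common_denominator (fun p : 'I_(\dim {:L}) * 'I_(\dim {:L}) => A p.1 p.2).
exists N => //.
have n0 : (0 < \dim {:L})%N by rewrite adim_gt0.
have be : basis_of {:L} e := vbasisP _.
apply: (@integral_of_int_matrix _ (\matrix_(j, i) m (j, i)) (fun i => e`_i)).
  exists (Ordinal n0); have := basis_not0 be; apply; apply: mem_nth.
  by rewrite size_tuple.
move=> j; rewrite -mulrA.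
rewrite {1}(coord_basis be (memvf (x * e`_j))) mulr_sumr; apply: eq_bigr => i _.
have h : N%:R * A j i = (m (j, i))%:~R := hm (j, i).
rewrite mxE -/(A j i) -scalerAr mulr_natl -scaler_nat scalerA mulrC h.
by rewrite scaler_int mulrzl.
Qed.

(** Two of the elements N c^k agree modulo N, so r = c^j - c^i is integral and c is a root of the
    monic polynomial X^j - X^i - r over the integral elements. *)
Lemma OL_completely_integrally_closed :
  finite_quotients OL -> completely_integrally_closed OL.
Proof.
move=> hfin N c N0 hN.
have ON : OL N by have := hN 0; rewrite mulr1.
have [T [k hk]] := hfin N ON N0.
have [|i [j [ij]]] := @pigeonhole_mult _ OL N T k _ (fun i => N * c ^+ i) hN.
  by move=> x y; exact: hk.
rewrite /mult -mulrBr mulKf // => hr.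
set r := c ^+ j - c ^+ i in hr.
pose p : {poly L} := 'X^j - ('X^i + r%:P).
have sz : (size (- ('X^i + r%:P) : {poly L}) < size ('X^j : {poly L}))%N.
  rewrite size_polyN size_polyXn; apply: leq_ltn_trans (size_polyD _ _) _.
  rewrite size_polyXn gtn_max ltnS ij /=.
  apply: leq_ltn_trans (size_polyC_leq1 _) _.
  by rewrite ltnS; apply: leq_ltn_trans ij.
apply: (@integral_root_monic _ _ _ c p).
- by rewrite monicE lead_coefDl // lead_coefXn.
- by rewrite /root hornerD hornerN hornerD !hornerXn hornerC /r; apply/eqP; ring.
apply/integral_poly => l; rewrite coefB coefD !coefXn coefC.
apply: integral_sub; first exact: integral_nat.
apply: integral_add; first exact: integral_nat.
by case: ifP => _; [exact: hr|exact: integral0].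
Qed.

(** The size m is a priori unrelated to \dim L, so the base change matrices Q and Q' are
    rectangular. They are inverse to each other on both sides, and cyclicity of the trace
    concludes. *)
Lemma field_trace_family m (f : 'I_m -> L) (A : 'M[rat]_m) x :
  (forall c : 'I_m -> rat, \sum_i c i *: f i = 0 -> forall i, c i = 0) ->
  (forall y, exists c : 'I_m -> rat, y = \sum_i c i *: f i) ->
  (forall j, x * f j = \sum_i A j i *: f i) -> field_trace x = \tr A.
Proof.
move=> ffree fspan hA; pose e := vbasis {:L}.
have be : basis_of {:L} e := vbasisP _.
have ecoord y : y = \sum_i coord e i y *: e`_i := coord_basis be (memvf y).
have [q hq] := choice fspan.
pose Q : 'M[rat]_(\dim {:L}, m) := \matrix_(k, j) q e`_k j.
pose Q' : 'M[rat]_(m, \dim {:L}) := \matrix_(j, k) coord e k (f j).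
have hQ (k : 'I_(\dim {:L})) : e`_k = \sum_j Q k j *: f j.
  by rewrite {1}(hq e`_k); apply: eq_bigr => j _; rewrite mxE.
have hQ' j : f j = \sum_k Q' j k *: e`_k.
  by rewrite {1}(ecoord (f j)); apply: eq_bigr => k _; rewrite mxE.
have funiq (c d : 'I_m -> rat) :
    \sum_i c i *: f i = \sum_i d i *: f i -> forall i, c i = d i.
  move=> h i; apply/eqP; rewrite -subr_eq0; apply/eqP.
  apply: (ffree (fun i => c i - d i)).
  under eq_bigr do rewrite scalerBl.
  by rewrite sumrB h subrr.
have Q'Q : Q' *m Q = 1%:M.
  apply/matrixP => j i; apply: (funiq ((Q' *m Q) j) ((1%:M : 'M_m) j)).
  rewrite -lincomb_mulmx; under eq_bigr do rewrite -hQ.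
  rewrite -hQ' (bigD1 j) //= mxE eqxx scale1r big1 ?addr0 // => l lj.
  by rewrite mxE eq_sym (negPf lj) scale0r.
pose B : 'M[rat]_(\dim {:L}) := \matrix_(k, l) coord e l (x * e`_k).
have BQ : B *m Q = Q *m A.
  apply/matrixP => k i; apply: (funiq ((B *m Q) k) ((Q *m A) k)).
  rewrite -!lincomb_mulmx; under [RHS]eq_bigr do rewrite -hA scalerAr.
  rewrite -mulr_sumr -hQ; under eq_bigr do rewrite -hQ.
  by rewrite [RHS]ecoord; apply: eq_bigr => l _; rewrite mxE.
have QQ' : Q *m Q' = 1%:M.
  apply/matrixP => k l.
  have -> : (Q *m Q') k l = coord e l (\sum_i (Q *m Q') k i *: e`_i).
    by rewrite coord_sum_free // (basis_free be).
  rewrite -lincomb_mulmx; under eq_bigr do rewrite -hQ'.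
  by rewrite -hQ coord_free ?(basis_free be) // mxE.
have -> : field_trace x = \tr B by apply: eq_bigr => i _; rewrite mxE.
have -> : B = Q *m A *m Q' by rewrite -BQ -mulmxA QQ' mulmx1.
by rewrite -mulmxA mxtrace_mulC -mulmxA Q'Q mulmx1.
Qed.

Lemma field_traceD x y : field_trace (x + y) = field_trace x + field_trace y.
Proof.
by rewrite /field_trace -big_split; apply: eq_bigr => i _; rewrite mulrDl linearD.
Qed.

Lemma field_traceZ (a : rat) x : field_trace (a *: x) = a * field_trace x.
Proof.
by rewrite /field_trace mulr_sumr; apply: eq_bigr => i _; rewrite -scalerAl linearZ.
Qed.

Lemma field_traceN x : field_trace (- x) = - field_trace x.
Proof. by rewrite -scaleN1r field_traceZ mulN1r. Qed.

Lemma field_trace1 : field_trace (1 : L) = (\dim {:L})%:R.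
Proof.
transitivity (\sum_(i < \dim {:L}) (1 : rat)); last by rewrite sumr_const card_ord.
apply: eq_bigr => i _; rewrite mul1r coord_free ?eqxx //.
exact: basis_free (vbasisP _).
Qed.

Lemma field_trace_nondeg x : (forall y, field_trace (x * y) = 0) -> x = 0.
Proof.
move=> h; apply/eqP/negPn/negP => x0; have := h x^-1.
rewrite mulfV // field_trace1 => /eqP; rewrite pnatr_eq0.
by rewrite -leqn0 leqNgt adim_gt0.
Qed.

End NumberField.

Lemma OL_subvs (K : fieldExtType rat) (K0 : {subfield K}) (x : subvs_of K0) :
  ring_of_integers (subvs_of K0) x <-> ring_of_integers K (vsval x).
Proof.
have e : forall p : {poly int},
    map_poly (intr : int -> K) p = map_poly vsval (map_poly (intr : int -> subvs_of K0) p).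
  by move=> p; rewrite -map_poly_comp; apply: eq_map_poly => n /=; rewrite rmorph_int.
split=> -[p pm hp]; exists p => //.
  by rewrite e fmorph_root.
by move: hp; rewrite e fmorph_root.
Qed.

Lemma natr_ext_neq0 (K : fieldExtType rat) n : (0 < n)%N -> (n%:R : K) != 0.
Proof. by move=> n0; rewrite -(rmorph_nat (in_alg K)) fmorph_eq0 pnatr_eq0 -lt0n. Qed.

(** * The trace and complex conjugation *)

Section ConjugationTrace.
Variables (K : fieldExtType rat) (K0 : {subfield K}) (bar : {rmorphism K -> K}).
Hypothesis barK : forall x, bar (bar x) = x.
Hypothesis bar_fixed : forall x, bar x = x <-> exists c : subvs_of K0, x = vsval c.
Hypothesis bar_nontrivial : exists x, bar x != x.
Local Notation OK := (ring_of_integers K).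
Implicit Types x y u v : K.

Lemma barZ (a : rat) x : bar (a *: x) = a *: bar x.
Proof.
rewrite -[a *: x]mulr_algl -[a *: bar x]mulr_algl rmorphM; congr (_ * _).
by rewrite alg_num_field fmorph_rat.
Qed.

(** In the conjugated basis, multiplication by bar x has the matrix that multiplication by x has in
    the original basis. *)
Lemma field_trace_bar x : field_trace (bar x) = field_trace x.
Proof.
pose e := vbasis {:K}; have be : basis_of {:K} e := vbasisP _.
have ecoord y : y = \sum_i coord e i y *: e`_i := coord_basis be (memvf y).
have bsum (c : 'I_(\dim {:K}) -> rat) :
    bar (\sum_i c i *: e`_i) = \sum_i c i *: bar e`_i.
  by rewrite rmorph_sum; apply: eq_bigr => i _; rewrite barZ.
rewrite (@field_trace_family _ _ (fun i : 'I_(\dim {:K}) => bar e`_i)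
          (\matrix_(j, i) coord e i (x * e`_j))).
- by apply: eq_bigr => i _; rewrite mxE.
- move=> c; rewrite -bsum => /eqP; rewrite fmorph_eq0 => /eqP h.
  by move/freeP: (basis_free be); apply.
- by move=> y; exists (fun i => coord e i (bar y)); rewrite -bsum -ecoord barK.
move=> j; rewrite -rmorphM {1}(ecoord (x * e`_j)) bsum.
by apply: eq_bigr => i _; rewrite mxE.
Qed.

Lemma antifixed_exists : exists2 h, bar h = - h & h != 0.
Proof.
have [x hx] := bar_nontrivial; exists (x - bar x).
  by rewrite rmorphB barK opprB.
by rewrite subr_eq0 eq_sym.
Qed.

Lemma fixed_vsval (c : subvs_of K0) : bar (vsval c) = vsval c.
Proof. by apply/bar_fixed; exists c. Qed.

Lemma two_neq0 : (2%:R : K) != 0.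
Proof. exact: natr_ext_neq0. Qed.

(** For h with bar h = -h, K is the direct sum of K0 and K0 h, and c acts on both summands by the
    same matrix. *)
Lemma field_trace_vsval (c : subvs_of K0) :
  field_trace (vsval c) = 2%:R * field_trace c.
Proof.
have [h hh h0] := antifixed_exists.
pose n := \dim {:subvs_of K0}; pose e := vbasis {:subvs_of K0}.
have be : basis_of {:subvs_of K0} e := vbasisP _.
have ecoord (w : subvs_of K0) : w = \sum_i coord e i w *: e`_i := coord_basis be (memvf w).
pose f (i : 'I_(n + n)) : K :=
  match fintype.split i with inl j => vsval e`_j | inr j => vsval e`_j * h end.
pose B : 'M[rat]_n := \matrix_(j, i) coord e i (c * e`_j).
have fl j : f (lshift n j) = vsval e`_j by rewrite /f (unsplitK (inl j)).
have fr j : f (rshift n j) = vsval e`_j * h by rewrite /f (unsplitK (inr j)).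
have vsum (a : 'I_n -> rat) : \sum_i a i *: vsval e`_i = vsval (\sum_i a i *: e`_i).
  by rewrite linear_sum; apply: eq_bigr => i _; rewrite linearZ.
have fsum (a : 'I_(n + n) -> rat) : \sum_i a i *: f i =
    vsval (\sum_i a (lshift n i) *: e`_i) + vsval (\sum_i a (rshift n i) *: e`_i) * h.
  rewrite big_split_ord /= -!vsum mulr_suml; congr (_ + _).
    by apply: eq_bigr => i _; rewrite fl.
  by apply: eq_bigr => i _; rewrite fr scalerAl.
rewrite (@field_trace_family _ _ f (block_mx B 0 0 B)).
- rewrite mxtrace_block mulr_natl mulr2n.
  by congr (_ + _); apply: eq_bigr => i _; rewrite mxE.
- move=> a; rewrite fsum.
  set p := vsval _; set q := vsval _ => e0.
  have e1 : p - q * h = 0.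
    have := congr1 bar e0; rewrite rmorph0 rmorphD rmorphM hh !fixed_vsval.
    by rewrite mulrN.
  have p0 : p = 0.
    apply/eqP; rewrite -(mulrI_eq0 _ (mulfI two_neq0)); apply/eqP.
    by rewrite mulr_natl mulr2n -{2}[p](addrNK (q * h)) e1 add0r.
  have q0 : q = 0.
    by apply/eqP; have := e0; rewrite p0 add0r => /eqP; rewrite mulf_eq0 (negPf h0) orbF.
  have fr0 : forall b : 'I_n -> rat, vsval (\sum_i b i *: e`_i) = 0 -> forall i, b i = 0.
    move=> b hb; move/freeP: (basis_free be); apply.
    by apply: val_inj; rewrite /= hb.
  move=> i; rewrite -(splitK i); case: (fintype.split i) => j /=.
    exact: (fr0 (fun i => a (lshift n i)) p0).
  exact: (fr0 (fun i => a (rshift n i)) q0).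
- move=> y.
  have [p hp] : exists p : subvs_of K0, (y + bar y) / 2%:R = vsval p.
    by apply/bar_fixed; rewrite rmorphM fmorphV rmorph_nat rmorphD barK addrC.
  have [q hq] : exists q : subvs_of K0, (y - bar y) / (2%:R * h) = vsval q.
    apply/bar_fixed; rewrite rmorphM fmorphV rmorphM rmorph_nat rmorphB barK hh.
    by rewrite mulrN invrN mulrN -mulNr opprB.
  exists (fun i => match fintype.split i with inl j => coord e j p | inr j => coord e j q end).
  rewrite fsum.
  under eq_bigr do rewrite (unsplitK (inl _)).
  under [X in _ + vsval X * _]eq_bigr do rewrite (unsplitK (inr _)).
  rewrite -!ecoord -hp -hq; field.
  by rewrite h0 two_neq0.
move=> j; rewrite fsum -[j]splitK; case: (fintype.split j) => k /=.
  rewrite fl; under eq_bigr do rewrite block_mxEul mxE.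
  under [X in _ + vsval X * _]eq_bigr do rewrite block_mxEur mxE scale0r.
  by rewrite -ecoord big1 // linear0 mul0r addr0 rmorphM.
rewrite fr; under eq_bigr do rewrite block_mxEdl mxE scale0r.
under [X in _ + vsval X * _]eq_bigr do rewrite block_mxEdr mxE.
by rewrite big1 // linear0 add0r -ecoord rmorphM mulrA.
Qed.

Lemma integral_bar x : OK x -> OK (bar x).
Proof.
case=> p pm hp; exists p => //.
have -> : map_poly (intr : int -> K) p = map_poly bar (map_poly intr p).
  by rewrite -map_poly_comp; apply: eq_map_poly => n /=; rewrite rmorph_int.
by rewrite fmorph_root.
Qed.

End ConjugationTrace.

(** * Self-dual ideals are free over the real subring *)

Lemma half_double (a : rat) : (a + a) / 2%:R = a.
Proof. by field. Qed.

Section SelfDualIdeal.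
Variables (K : fieldExtType rat) (K0 : {subfield K}) (bar : {rmorphism K -> K}).
Hypothesis barK : forall x, bar (bar x) = x.
Hypothesis bar_fixed : forall x, bar x = x <-> exists c : subvs_of K0, x = vsval c.
Hypothesis bar_nontrivial : exists x, bar x != x.
Local Notation OK := (ring_of_integers K).
Hypothesis OK_finite : finite_quotients OK.
Variables (I : set K) (xi : K).
Hypothesis I_ideal : fractional_ideal I.
Hypothesis xi_neq0 : xi != 0.
Hypothesis bar_xi : bar xi = - xi.
Hypothesis I_int : forall x y, I x -> I y -> field_trace (xi * x * bar y) \is a Num.int.
Hypothesis I_dual : forall x,
  (forall y, I y -> field_trace (xi * x * bar y) \is a Num.int) -> I x.
Implicit Types x y u v w d : K.

Let hO : subring OK := OL_subring K.
Let hOci : completely_integrally_closed OK := OL_completely_integrally_closed OK_finite.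

Lemma ideal_submodule : submodule_over OK I. Proof. by case: I_ideal. Qed.
Lemma idealB x y : I x -> I y -> I (x - y).
Proof. by case: ideal_submodule => _ h _; exact: h. Qed.
Lemma idealM r x : OK r -> I x -> I (r * x).
Proof. by case: ideal_submodule => _ _; exact. Qed.
Lemma idealD x y : I x -> I y -> I (x + y).
Proof. exact: (submoduleD ideal_submodule). Qed.

Lemma ideal_stabilizer c : (forall x, I x -> I (c * x)) -> OK c.
Proof.
case: I_ideal => _ hx [d d0 hd].
exact: (almost_integral_colon hOci ideal_submodule hx d0 hd).
Qed.

Lemma codifferent_submodule : submodule_over OK (codifferent K).
Proof.
split=> [y _|x y hx hy z hz|r x hr hx y hy].
- by rewrite mul0r -(scale0r 1) field_traceZ mul0r.
- rewrite mulrBl field_traceD field_traceN; apply: rpredB; [exact: hx|exact: hy].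
- by rewrite mulrAC mulrC; apply: hx; exact: (subringM hO).
Qed.

Lemma ideal_pairing_codifferent x y : I x -> I y -> codifferent K (xi * x * bar y).
Proof.
move=> hx hy r hr.
have -> : xi * x * bar y * r = xi * (r * x) * bar y by ring.
by apply: I_int => //; exact: idealM.
Qed.

Lemma codifferent_nonzero : exists2 c, codifferent K c & c != 0.
Proof.
case: I_ideal => _ [x hx x0] _; exists (xi * x * bar x).
  exact: ideal_pairing_codifferent.
by rewrite !mulf_neq0 // fmorph_eq0.
Qed.

(** With w xi x ybar integral for x, y in I, self-duality shows that w c maps I to itself for c in
    the codifferent. Choosing w fixed by [bar] lets the same bound serve for K0. *)
Lemma codifferent_bounded : exists w, [/\ w != 0, bar w = w
  & forall c, codifferent K c -> OK (w * c)].
Proof.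
case: I_ideal => _ _ [d d0 hd].
have [e e0 he] := clear_denominator xi.
have en0 : (e%:R : K) != 0 by exact: natr_ext_neq0.
exists (e%:R * (d * bar d)); split.
- by rewrite !mulf_neq0 // fmorph_eq0.
- by rewrite !rmorphM rmorph_nat barK [bar d * d]mulrC.
move=> c hc; apply: ideal_stabilizer => x hx; apply: I_dual => y hy.
have -> : xi * (e%:R * (d * bar d) * c * x) * bar y =
    c * ((e%:R * xi) * (d * x) * bar (d * y)) by rewrite rmorphM; ring.
apply: hc; apply: (subringM hO); last by apply: integral_bar; exact: hd.
by apply: (subringM hO) => //; exact: hd.
Qed.

(** Invertibility of the codifferent writes 1 as a sum of products c_i d_i with d_i in the
    different, and y is the sum of the (y d_i) c_i. *)
Lemma different_inverse y :
  (forall d, different K d -> OK (y * d)) -> codifferent K y.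
Proof.
move=> hy; have [w [w0 _ hw]] := codifferent_bounded.
have [s [hs e]] := colon_invertible hO OK_finite hOci codifferent_submodule
  codifferent_nonzero w0 hw.
rewrite -[y]mulr1 -e mulr_sumr big_seq; apply: (big_ind (codifferent K)).
- by case: codifferent_submodule.
- by move=> a b; exact: (submoduleD codifferent_submodule).
move=> p hp; have [h1 h2] := hs p hp.
rewrite mulrCA mulrC; case: codifferent_submodule => _ _; apply => //.
exact: hy.
Qed.

(** For x in the left-hand side, each x u vbar lies in the codifferent, so x/xi maps I into its dual
    I and is integral. Conversely each xi u vbar lies in the codifferent, which the different
    multiplies into O_K. *)
Lemma inverse_polarization_ideal :
  ideal_inv (ideal_mul (ideal_mul I (bar @` I)) (different K)) = principal_ideal xi.
Proof.
have idmul1 (J1 J2 : set K) a b : J1 a -> J2 b -> ideal_mul J1 J2 (a * b).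
  by move=> ha hb; exists 1%N, (fun=> a), (fun=> b); split=> //; rewrite big_ord1.
apply/seteqP; split=> x.
  move=> hx; exists (x / xi); last by rewrite mulrC divfK.
  apply: ideal_stabilizer => u hu; apply: I_dual => v hv.
  have -> : xi * (x / xi * u) * bar v = x * (u * bar v) by field.
  rewrite -[_ * (u * _)]mulr1; apply: different_inverse; last exact: (subring1 hO).
  move=> d hd; rewrite -mulrA; apply: hx; apply: (idmul1) => //.
  by apply: (idmul1) => //; exists v.
case=> r hr <- y [n [a [b [hab ->]]]].
rewrite mulr_sumr; apply: (subring_sum hO) => i; have [ha hb] := hab i.
rewrite mulrA mulrC; apply: hb.
case: ha => m [u [v [huv ->]]].
rewrite mulr_sumr; apply: (submodule_sum _ _ codifferent_submodule) => j.
have [hu [v' hv' <-]] := huv j.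
have -> : xi * r * (u j * bar v') = r * (xi * u j * bar v') by ring.
by case: codifferent_submodule => _ _; apply => //; exact: ideal_pairing_codifferent.
Qed.

(** The integers of K0 as a subset of K, so that scalars and the elements of I live in one field. *)
Definition O0 : set K := [set x | OK x /\ bar x = x].

Lemma O0_subring : subring O0.
Proof.
split; first by split; [exact: (subring1 hO)|rewrite rmorph1].
  by move=> x y [hx ex] [hy ey]; split; [exact: (subringB hO)|rewrite rmorphB ex ey].
by move=> x y [hx ex] [hy ey]; split; [exact: (subringM hO)|rewrite rmorphM ex ey].
Qed.

Lemma O0_finite : finite_quotients O0.
Proof.
move=> N [hN eN] N0; have [T [k hk]] := OK_finite hN N0; exists T, k.
move=> x y [hx ex] [hy ey] e; split; first exact: hk.
by rewrite rmorphM fmorphV rmorphB eN ex ey.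
Qed.

Lemma O0_completely_integrally_closed : completely_integrally_closed O0.
Proof.
move=> N c N0 hN; split; first by apply: (hOci N0) => n; case: (hN n).
have [_ e0] := hN 0%N; have [_ e1] := hN 1%N.
rewrite expr0 mulr1 in e0; rewrite expr1 rmorphM e0 in e1.
exact: (mulfI N0).
Qed.

(* The codifferent of K0 inside K; the trace is halved because Tr_{K/Q} is twice
   Tr_{K0/Q} on K0. *)
Definition C0 : set K :=
  [set c | bar c = c /\ forall r, O0 r -> field_trace (c * r) / 2%:R \is a Num.int].

Lemma C0_codifferent (c : subvs_of K0) : C0 (vsval c) <-> codifferent (subvs_of K0) c.
Proof.
have e (r : subvs_of K0) : field_trace (vsval c * vsval r) / 2%:R = field_trace (c * r).
  rewrite -rmorphM (field_trace_vsval barK bar_fixed bar_nontrivial).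
  by rewrite mulrC mulKf // pnatr_eq0.
split=> [[_ h] r /OL_subvs hr|h].
  by rewrite -e; apply: h; split=> //; exact: (fixed_vsval bar_fixed).
split; first exact: (fixed_vsval bar_fixed).
move=> r [hr /bar_fixed [r' er]]; rewrite er e; apply: h.
by apply/OL_subvs; rewrite -er.
Qed.

Lemma C0_submodule : submodule_over O0 C0.
Proof.
split=> [|x y [ex hx] [ey hy]|r x [hr er] [ex hx]].
- split; first by rewrite rmorph0.
  by move=> r _; rewrite mul0r -(scale0r 1) field_traceZ !mul0r.
- split; first by rewrite rmorphB ex ey.
  move=> r hr; rewrite mulrBl field_traceD field_traceN mulrBl.
  by apply: rpredB; [exact: hx|exact: hy].
split; first by rewrite rmorphM ex er.
move=> s hs; have -> : r * x * s = x * (r * s) by ring.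
apply: hx.
by apply: (subringM O0_subring).
Qed.

(** Times a real r, the element is t + bar t with t = xi (r u) vbar, because bar xi = -xi; half its
    trace is Tr(t), an integer. *)
Lemma alternating_C0 u v : I u -> I v -> C0 (xi * (u * bar v - bar u * v)).
Proof.
move=> hu hv; split.
  by rewrite rmorphM rmorphB !rmorphM !barK bar_xi; ring.
move=> r [hr er].
have -> : xi * (u * bar v - bar u * v) * r =
    xi * (r * u) * bar v + bar (xi * (r * u) * bar v).
  by rewrite !rmorphM barK bar_xi er; ring.
rewrite field_traceD (field_trace_bar barK) half_double.
by apply: I_int => //; exact: idealM.
Qed.

Lemma half_trace_alternating u v :
  field_trace (xi * u * bar v) = field_trace (xi * (u * bar v - bar u * v)) / 2%:R.
Proof.
have -> : xi * (u * bar v - bar u * v) = xi * u * bar v + bar (xi * u * bar v).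
  by rewrite !rmorphM barK bar_xi; ring.
by rewrite field_traceD (field_trace_bar barK) half_double.
Qed.

(** Take v = n x u with x not real: the value is n (x - xbar) u ubar. *)
Lemma alternating_nonzero u : I u -> u != 0 ->
  exists2 v, I v & v * bar u - bar v * u != 0.
Proof.
move=> hu u0; have [x hx] := bar_nontrivial.
have [n n0 hn] := clear_denominator x.
exists (n%:R * x * u); first exact: idealM.
have -> : n%:R * x * u * bar u - bar (n%:R * x * u) * u =
    n%:R * ((x - bar x) * (u * bar u)) by rewrite !rmorphM rmorph_nat; ring.
apply: mulf_neq0; first exact: natr_ext_neq0.
by apply: mulf_neq0; rewrite ?mulf_neq0 ?fmorph_eq0 // subr_eq0 eq_sym.
Qed.

Lemma C0_nonzero : exists2 c, C0 c & c != 0.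
Proof.
case: I_ideal => _ [u hu u0] _; have [v hv h] := alternating_nonzero hu u0.
by exists (xi * (v * bar u - bar v * u)); [exact: alternating_C0|rewrite mulf_neq0].
Qed.

Variable delta : subvs_of K0.
Hypothesis delta_different :
  different (subvs_of K0) = principal_ideal delta.
Local Notation dl := (vsval delta).

(** For r in O_K, Tr(c r) is half of Tr(c (r + rbar)) and r + rbar is in [O0]; hence [C0] lies in
    the codifferent of K and inherits its bound. *)
Lemma C0_bounded : exists2 w, w != 0 & forall c, C0 c -> O0 (w * c).
Proof.
have [w [w0 ew hw]] := codifferent_bounded; exists w => // c [ec hc].
split; last by rewrite rmorphM ew ec.
apply: hw => r hr.
have -> : field_trace (c * r) = field_trace (c * (r + bar r)) / 2%:R.
  rewrite mulrDr field_traceD; have -> : c * bar r = bar (c * r) by rewrite rmorphM ec.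
  by rewrite (field_trace_bar barK) half_double.
apply: hc; split; last by rewrite rmorphD barK addrC.
by apply: (subringD hO) => //; exact: integral_bar.
Qed.

(** The hypothesis describes only the inverse of the codifferent; invertibility leads back. In 1 =
    sum of p_i q_i with p_i in [C0] and q_i in its inverse, every q_i is a multiple of delta, so 1 =
    delta t with t in [C0]. *)
Lemma C0_principal : dl != 0 /\ forall c, C0 c <-> O0 (dl * c).
Proof.
have [w w0 hw] := C0_bounded.
have [c0 hc0 c00] := C0_nonzero.
have [s [hs e]] := colon_invertible O0_subring O0_finite
  O0_completely_integrally_closed C0_submodule C0_nonzero w0 hw.
have edl : bar dl = dl by exact: (fixed_vsval bar_fixed).
have colonE y : colon O0 C0 y -> exists2 r, O0 r & y = dl * r.
  move=> hy; have [_ ey] := hy _ hc0; case: (hc0) => ec0 _.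
  have /bar_fixed [y' ey'] : bar y = y.
    by rewrite rmorphM ec0 in ey; exact: (mulIf c00).
  have : different (subvs_of K0) y'.
    move=> c /C0_codifferent hc; apply/OL_subvs.
    have -> : vsval (y' * c) = y * vsval c by rewrite ey' rmorphM.
    by case: (hy _ hc).
  rewrite delta_different => -[r hr er]; exists (vsval r).
    by split; [exact/OL_subvs|exact: (fixed_vsval bar_fixed)].
  by rewrite ey' -er rmorphM.
have dl_colon c : C0 c -> O0 (dl * c).
  move=> hc; case: (hc) => ec _; split; last by rewrite rmorphM edl ec.
  have /bar_fixed [c' ec'] := ec; rewrite ec' -rmorphM; apply/OL_subvs.
  have : different (subvs_of K0) delta.
    by rewrite delta_different; exists 1; [exact: integral1|rewrite mulr1].
  by apply; apply/C0_codifferent; rewrite -ec'.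
have [t ht et] : exists2 t, C0 t & dl * t = 1.
  suff [t ht et] : exists2 t, C0 t & dl * t = \sum_(p <- s) p.1 * p.2.
    by exists t => //; rewrite et.
  elim: s hs {e} => [|p s ih] hs.
    by exists 0; [case: C0_submodule|rewrite mulr0 big_nil].
  have [|t ht et] := ih; first by move=> q hq; apply: hs; rewrite inE hq orbT.
  have [|h1 h2] := hs p; first by rewrite mem_head.
  have [r hr er] := colonE _ h2.
  exists (r * p.1 + t).
    by apply: (submoduleD C0_submodule) => //; case: C0_submodule => _ _; exact.
  by rewrite big_cons -et er; ring.
have dl0 : dl != 0.
  by apply/eqP => h; move/eqP: et; rewrite h mul0r eq_sym oner_eq0.
split=> // c; split; first exact: dl_colon.
move=> hc; have -> : c = dl * c * t by rewrite mulrAC et mul1r.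
by case: C0_submodule => _ _; exact.
Qed.

(** Delta times the relative trace from K to K0 of xi u vbar. *)
Let B u v := dl * xi * (u * bar v - bar u * v).

Lemma alternating_O0 u v : I u -> I v -> O0 (B u v).
Proof.
by move=> hu hv; rewrite /B -mulrA; case: C0_principal => _ <-; exact: alternating_C0.
Qed.

(** Then B(u,v)/delta is in [C0]; testing it against r = 1 makes Tr(xi u vbar) an integer, and I is
    its own dual. *)
Lemma alternating_perfect u : (forall v, I v -> O0 (B u v)) -> I u.
Proof.
move=> h; apply: I_dual => v hv; rewrite half_trace_alternating -[_ * (_ - _)]mulr1.
have [_ hc] : C0 (xi * (u * bar v - bar u * v)).
  by case: C0_principal => _ ->; rewrite mulrA; exact: h.
by apply: hc; exact: (subring1 O0_subring).
Qed.

(** Values of B glue by gluing both arguments: all cross terms carry the factor e (1 - e). If s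
    kills all values modulo N, perfectness shows that s/N maps I to itself, so s is a multiple of
    N. *)
Lemma pairing_one_modulo N : O0 N -> N != 0 ->
  exists x y, [/\ I x, I y & O0 (N^-1 * (B x y - 1))].
Proof.
move=> hN N0; have [T [k hk]] := O0_finite hN N0.
pose P : set K := [set p | exists x y, [/\ I x, I y & p = B x y]].
have PO : P `<=` O0 by move=> _ [x [y [hx hy ->]]]; exact: alternating_O0.
have P0 : P 0.
  by exists 0, 0; case: ideal_submodule => I0 _ _; split=> //; rewrite /B rmorph0; ring.
have [|[_ [x [y [hx hy ->]]] h]|[s [hs ns h]]] :=
    one_or_annihilator O0_subring N0 hk PO P0.
- move=> e p n Pe Pp; move: (PO _ Pe) (PO _ Pp) => [Oe ee] [Op ep].
  case: Pe Pp => x [y [hx hy Ee]] [x' [y' [hx' hy' Ep]]] idem.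
  (* Scaling y' by t raises the value p to the required power on the factor 1 - e. *)
  pose t := ((1 - e) * p) ^+ n.
  have O1e : OK (1 - e) by apply: (subringB hO) => //; exact: (subring1 hO).
  have Ot : OK t by apply: (subringX hO); exact: (subringM hO).
  have et : bar t = t by rewrite rmorphXn rmorphM rmorphB rmorph1 ee ep.
  exists (B (e * x + (1 - e) * x') (e * y + (1 - e) * t * y')).
    exists (e * x + (1 - e) * x'), (e * y + (1 - e) * t * y'); split=> //.
      by apply: idealD; exact: idealM.
    by apply: idealD; apply: idealM => //; exact: (subringM hO).
  have -> : B (e * x + (1 - e) * x') (e * y + (1 - e) * t * y') -
      (e + ((1 - e) * p) ^+ n.+1) =
      (e * e - e) * (e + 1 - t * B x y' - B x' y + t * p).
    have -> : (e * e - e) * (e + 1 - t * B x y' - B x' y + t * p) =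
      e * e * B x y + e * (1 - e) * (t * B x y' + B x' y) +
      (1 - e) * (1 - e) * t * B x' y' - e - t * ((1 - e) * p).
      by rewrite -Ee -Ep; ring.
    by rewrite exprSr -/t /B !rmorphD !rmorphM !rmorphB rmorph1 ee et; ring.
  apply: (multM O0_subring) => //.
  have [Oxy' Ox'y] : O0 (B x y') /\ O0 (B x' y) by split; exact: alternating_O0.
  have O0e : O0 e by [].
  have O0t : O0 t by [].
  have O0p : O0 p by [].
  have O01 := subring1 O0_subring.
  apply: (subringD O0_subring); last exact: (subringM O0_subring).
  apply: (subringB O0_subring) => //; apply: (subringB O0_subring).
    exact: (subringD O0_subring).
  exact: (subringM O0_subring).
- by exists x, y.
case: ns; have [Os es] := hs; case: (hN) => _ eN.
have esN : bar (N^-1 * s) = N^-1 * s by rewrite rmorphM fmorphV eN es.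
split=> //; apply: ideal_stabilizer => x hx; apply: alternating_perfect => y hy.
have -> : B (N^-1 * s * x) y = N^-1 * (s * B x y).
  by rewrite /B rmorphM esN; ring.
by apply: h; exists x, y.
Qed.

(* A vector y that is unimodular modulo B(x1,y1) is made unimodular modulo all of
   O0 by adding a multiple of x1; modulo N = B(y,x1) the good multiple is found by
   the idempotent argument, and N itself is a value of B(y + t x1, -). *)
Lemma unimodular_pair : exists x y, [/\ I x, I y & B x y = 1].
Proof.
have O01 := subring1 O0_subring.
case: (I_ideal) => _ [x1 hx1 x10] _.
have [y1 hy1 h1] := alternating_nonzero hx1 x10.
have [dl0 _] := C0_principal.
set M := B y1 x1; have M0 : M != 0 by rewrite /M /B !mulf_neq0.
have OM : O0 M by exact: alternating_O0.
have [y0 [z [hy0 hz hq]]] := pairing_one_modulo OM M0.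
(* B(y,x1) will be the next modulus and must not vanish. If B(y0,x1) = 0, adding M y1 to y0 changes
   it to M^2 and leaves B(y0,z) unchanged modulo M. *)
have [y [hy hyz N0]] : exists y, [/\ I y, O0 (M^-1 * (B y z - 1)) & B y x1 != 0].
  have [e|ne] := eqVneq (B y0 x1) 0; last by exists y0.
  case: (OM) => OM' eM.
  exists (y0 + M * y1); split; first by apply: idealD => //; exact: idealM.
    have -> : M^-1 * (B (y0 + M * y1) z - 1) = M^-1 * (B y0 z - 1) + B y1 z.
      by rewrite /B rmorphD rmorphM eM; field.
    by apply: (subringD O0_subring) => //; exact: alternating_O0.
  have -> : B (y0 + M * y1) x1 = B y0 x1 + M * M.
    by rewrite {3}/M /B rmorphD rmorphM eM; ring.
  by rewrite e add0r mulf_neq0.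
set N := B y x1 in N0.
have ON : O0 N by exact: alternating_O0.
have [T [k hk]] := O0_finite ON N0.
pose P : set K :=
  [set p | exists t m, [/\ O0 t, I m & p = B (y + t * x1) m]].
have ht t : O0 t -> I (y + t * x1).
  by case=> Ot et; apply: idealD => //; exact: idealM.
have PO : P `<=` O0.
  by move=> _ [t [m [Ot hm ->]]]; apply: alternating_O0 => //; exact: ht.
have O00 := subring0 O0_subring.
have P0 : P 0.
  by exists 0, 0; case: ideal_submodule => I0 _ _; split=> //; rewrite /B rmorph0; ring.
have [|[_ [t [m [Ot hm ->]]] h]|[s [hs ns h]]] :=
    one_or_annihilator O0_subring N0 hk PO P0.
- move=> e p n Pe Pp; move: (PO _ Pe) (PO _ Pp) => Oe Op.
  case: Pe Pp => t [m [Ot hm Ee]] [t' [m' [Ot' hm' Ep]]] idem.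
  pose f := ((1 - e) * p) ^+ n.
  have O1e : O0 (1 - e) by exact: (subringB O0_subring).
  have Of : O0 f by apply: (subringX O0_subring); exact: (subringM O0_subring).
  pose t'' := e * t + (1 - e) * t'.
  have Ot'' : O0 t'' by apply: (subringD O0_subring); exact: (subringM O0_subring).
  pose m'' := e * m + (1 - e) * f * m'.
  have hm'' : I m''.
    apply: idealD; apply: idealM => //; first by case: Oe.
    by case: (subringM O0_subring O1e Of).
  exists (B (y + t'' * x1) m''); first by exists t'', m''.
  move: (Oe) (Op) (Of) (Ot) (Ot') => [_ ee] [_ ep] [_ ef] [_ et] [_ et'].
  have -> : B (y + t'' * x1) m'' - (e + ((1 - e) * p) ^+ n.+1) =
      (e * e - e) * (e + 1 - f * B (y + t * x1) m' - B (y + t' * x1) m + f * p).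
    have -> : (e * e - e) *
        (e + 1 - f * B (y + t * x1) m' - B (y + t' * x1) m + f * p) =
      e * e * B (y + t * x1) m +
      e * (1 - e) * (f * B (y + t * x1) m' + B (y + t' * x1) m) +
      (1 - e) * (1 - e) * f * B (y + t' * x1) m' - e - f * ((1 - e) * p).
      by rewrite -Ee -Ep; ring.
    rewrite exprSr -/f /t'' /m'' /B !(rmorphD, rmorphM, rmorphN).
    by rewrite rmorph1 ee ef et et'; ring.
  apply: (multM O0_subring) => //.
  apply: (subringD O0_subring); last exact: (subringM O0_subring).
  apply: (subringB O0_subring); last by apply: alternating_O0 => //; exact: ht.
  apply: (subringB O0_subring); first exact: (subringD O0_subring).
  by apply: (subringM O0_subring) => //; apply: alternating_O0 => //; exact: ht.
- move: h; rewrite /mult; set q := N^-1 * _.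
  have qE : N * q = B (y + t * x1) m - 1 by rewrite /q mulVKf.
  move: q qE => q qE [Oq eq].
  (* Since B(x1,x1) = 0, B(y + t x1, x1) = N whatever t is; subtracting q x1 from m removes the
     error N q exactly. *)
  exists (y + t * x1), (m - q * x1); split; first exact: ht.
    by apply: idealB => //; exact: idealM.
  case: (Ot) => _ et.
  have -> : B (y + t * x1) (m - q * x1) = B (y + t * x1) m - N * q.
    by rewrite /N /B !(rmorphD, rmorphM, rmorphN) eq et; ring.
  by rewrite qE; ring.
(* Taking t = 0 and t = 1, s kills B(y,-) and B(x1,-) modulo N. But B(y,z) is 1 modulo M =
   -B(x1,y1), so 1 is a combination of values of these two functionals and s itself is a multiple of
   N. *)
case: ns; rewrite /mult in h *.
have sy v : I v -> O0 (N^-1 * (s * B y v)).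
  by move=> hv; apply: h; exists 0, v; split=> //; rewrite mul0r addr0.
have sx v : I v -> O0 (N^-1 * (s * B x1 v)).
  move=> hv; have h2 : O0 (N^-1 * (s * B (y + x1) v)).
    by apply: h; exists 1, v; split=> //; rewrite mul1r.
  have -> : N^-1 * (s * B x1 v) = N^-1 * (s * B (y + x1) v) - N^-1 * (s * B y v).
    by rewrite /B rmorphD; ring.
  by apply: (subringB O0_subring) => //; exact: sy.
set q := M^-1 * _ in hyz.
have -> : N^-1 * s = N^-1 * (s * B y z) + q * (N^-1 * (s * B x1 y1)).
  have -> : B x1 y1 = - M by rewrite /M /B; ring.
  have -> : B y z = 1 + M * q by rewrite /q mulVKf //; ring.
  by ring.
apply: (subringD O0_subring); first exact: sy.
by apply: (subringM O0_subring) => //; exact: sx.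
Qed.

(** Cramer's rule in the K0-plane K: w B(x,y) = B(w,y) x - B(w,x) y, with B(x,y) = 1. *)
Lemma ideal_free : exists x y, [/\ I x, I y,
  dl * xi * (x * bar y - bar x * y) = 1
  & forall w, I w <-> exists a b, [/\ O0 a, O0 b & w = a * x + b * y]].
Proof.
have [x [y [hx hy e]]] := unimodular_pair.
exists x, y; split=> // w; split; last first.
  case=> a [b [[ha _] [hb _] ->]]; by apply: idealD; exact: idealM.
move=> hw; exists (B w y), (- B w x); split; first exact: alternating_O0.
  by apply: (subringN O0_subring); exact: alternating_O0.
by rewrite -[w in LHS]mulr1 -e /B; ring.
Qed.

End SelfDualIdeal.

(** * Lattices in complex vector spaces *)

Local Open Scope complex_scope.

Section ComplexCoordinates.
Variable R : realType.
Local Notation C := R[i].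
Implicit Types (t : R) (z w : C).

Lemma ReMreal t z : complex.Re (t%:C * z) = t * complex.Re z.
Proof. by case: z => a b /=; rewrite mul0r subr0. Qed.

Lemma ImMreal t z : complex.Im (t%:C * z) = t * complex.Im z.
Proof. by case: z => a b /=; rewrite mul0r addr0. Qed.

Lemma complex_eqP z w : complex.Re z = complex.Re w -> complex.Im z = complex.Im w -> z = w.
Proof. by case: z w => a b [c d] /= -> ->. Qed.

Lemma ratr_complex (a : rat) : ratr a = (ratr a : R)%:C :> C.
Proof. by rewrite (fmorph_rat (real_complex R)). Qed.

Lemma conj_ratr (a : rat) : conjc (ratr a : C) = ratr a.
Proof. by rewrite ratr_complex conjc_real. Qed.

Variable g : nat.
Local Notation V := 'cV[C]_g.

Definition realify (v : V) : 'rV[R]_(g + g) :=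
  row_mx (\row_i complex.Re (v i 0)) (\row_i complex.Im (v i 0)).

Lemma realify_inj : injective realify.
Proof.
move=> u v /eq_row_mx [/rowP hr /rowP hi]; apply/colP => i.
by apply: complex_eqP; [move: (hr i)|move: (hi i)]; rewrite !mxE.
Qed.

Lemma realify_sum (n : nat) (t : 'I_n -> R) (b : 'I_n -> V) :
  realify (\sum_i (t i)%:C *: b i) = \sum_i t i *: realify (b i).
Proof.
apply/rowP => j; rewrite summxE; case: (split_ordP j) => k ->.
  rewrite /realify row_mxEl mxE summxE raddf_sum; apply: eq_bigr => i _.
  by rewrite [in RHS]mxE row_mxEl !mxE; exact: ReMreal.
rewrite /realify row_mxEr mxE summxE raddf_sum; apply: eq_bigr => i _.
by rewrite [in RHS]mxE row_mxEr !mxE; exact: ImMreal.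
Qed.

Lemma real_coordinates (b : 'I_(2 * g) -> V) :
  (forall t : 'I_(2 * g) -> R, \sum_i (t i)%:C *: b i = 0 -> forall i, t i = 0) ->
  forall v, exists t : 'I_(2 * g) -> R, v = \sum_i (t i)%:C *: b i.
Proof.
move=> hfree v; pose T : 'M[R]_(2 * g, g + g) := \matrix_i realify (b i).
have hT (t : 'rV[R]_(2 * g)) : t *m T = realify (\sum_i (t 0 i)%:C *: b i).
  rewrite realify_sum mulmx_sum_row; apply: eq_bigr => i _.
  by rewrite rowK.
have Tfree : row_free T.
  apply: inj_row_free => t; rewrite hT => h.
  have h0 : \sum_i (t 0 i)%:C *: b i = 0.
    apply: realify_inj; rewrite h; apply/rowP => j.
    by rewrite /realify !mxE; case: (fintype.split j) => k; rewrite !mxE.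
  by apply/rowP => i; rewrite (hfree _ h0 i) mxE.
have Tfull : row_full T.
  by rewrite /row_full; move: Tfree; rewrite /row_free => /eqP ->; rewrite mul2n addnn.
have /submxP [t ht] : (realify v <= T)%MS by exact: submx_full.
by exists (fun i => t 0 i); apply: realify_inj; rewrite ht hT.
Qed.

End ComplexCoordinates.

(** * Extending the action of O_K to K, and cyclic vectors *)

Section ExtendEmbedding.
Variables (R : realType) (g : nat) (K : fieldExtType rat).
Variables (A : polAV R g) (iota : K -> 'M[R[i]]_g).
Hypothesis hiota : CM_embedding A iota.
Local Notation C := R[i].
Local Notation OK := (ring_of_integers K).

Let hO : subring OK := OL_subring K.

(** J(x) is iota(N x)/N for a chosen N clearing x; [jE] shows independence of N, so sums and
    products can be computed with the common denominator N(x) N(y). *)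
Lemma extend_embedding : exists J : {rmorphism K -> 'M[C]_g},
  forall x, OK x -> J x = iota x.
Proof.
case: hiota => _ i1 iD iM _.
have i0 : iota 0 = 0.
  have := iD 0 0 (subring0 hO) (subring0 hO); rewrite addr0 => h.
  by apply: (addrI (iota 0)); rewrite -h addr0.
have iN x : OK x -> iota (- x) = - iota x.
  move=> hx; apply: (addrI (iota x)); rewrite -iD //; last exact: (subringN hO).
  by rewrite !subrr.
have in_ (n : nat) x : OK x -> iota (n%:R * x) = (n%:R : C) *: iota x.
  move=> hx; elim: n => [|n ih]; first by rewrite mul0r scale0r.
  rewrite -natr1 mulrDl mul1r iD //; last first.
    by apply: (subringM hO) => //; exact: (subring_nat hO).
  by rewrite ih -natr1 scalerDl scale1r.
have /choice [N hN] : forall x : K, exists N : nat, (0 < N)%N /\ OK (N%:R * x).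
  by move=> x; have [N N0 h] := clear_denominator x; exists N.
have N0 x : ((N x)%:R : C) != 0 by rewrite pnatr_eq0 -lt0n; case: (hN x).
pose j x : 'M[C]_g := (N x)%:R^-1 *: iota ((N x)%:R * x).
have jE (n : nat) x : (0 < n)%N -> OK (n%:R * x) -> j x = n%:R^-1 *: iota (n%:R * x).
  move=> n0 hn; have nn0 : (n%:R : C) != 0 by rewrite pnatr_eq0 -lt0n.
  have [_ hx] := hN x.
  apply: (scalerI (mulf_neq0 nn0 (N0 x))).
  rewrite /j !scalerA mulfK ?N0 // -(in_ n _ hx) [n%:R * (N x)%:R]mulrC mulfK //.
  by rewrite -(in_ (N x) _ hn); congr iota; ring.
have jO x : OK x -> j x = iota x.
  by move=> hx; rewrite (@jE 1%N) ?mul1r // invr1 scale1r.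
have jB : zmod_morphism j.
  move=> x y; have [nx hx] := hN x; have [ny hy] := hN y.
  have hx' : OK ((N x * N y)%:R * x).
    by rewrite natrM mulrAC mulrC; apply: (subringM hO) => //; exact: (subring_nat hO).
  have hy' : OK ((N x * N y)%:R * y).
    by rewrite natrM -mulrA; apply: (subringM hO) => //; exact: (subring_nat hO).
  have nn : (0 < N x * N y)%N by rewrite muln_gt0 nx ny.
  rewrite (jE _ _ nn hx') (jE _ _ nn hy') (jE (N x * N y)%N) //; last first.
    by rewrite mulrBr; exact: (subringB hO).
  by rewrite -scalerBr mulrBr (iD _ _ hx' (subringN hO hy')) (iN _ hy').
have jM : monoid_morphism j.
  split; first by rewrite jO // ; exact: (subring1 hO).
  move=> x y; have [nx hx] := hN x; have [ny hy] := hN y.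
  rewrite (@jE (N x * N y)%N); first last.
  - by rewrite natrM mulrACA; exact: (subringM hO).
  - by rewrite muln_gt0 nx ny.
  rewrite !natrM mulrACA iM // invfM -scalerA /j.
  by rewrite -[RHS]/(_ *m _) -scalemxAl -scalemxAr !scalerA mulrC.
pose J : {rmorphism K -> 'M[C]_g} :=
  HB.pack j (GRing.isZmodMorphism.Build _ _ j jB) (GRing.isMonoidMorphism.Build _ _ j jM).
by exists J.
Qed.

End ExtendEmbedding.

Section CyclicBasis.
Variables (R : realType) (g : nat) (K : fieldExtType rat).
Local Notation C := R[i].
Local Notation V := 'cV[C]_g.
Local Notation OK := (ring_of_integers K).
Variable J : {rmorphism K -> 'M[C]_g}.
Hypothesis dimK : \dim {:K} = (2 * g)%N.

Lemma rmorph_ratZ (a : rat) x : J (a *: x) = ratr a *: J x.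
Proof.
have d0 : ((denq a)%:~R : C) != 0 by rewrite intr_eq0 denq_neq0.
have e : (denq a)%:~R * a = (numq a)%:~R by rewrite mulrC -numqE.
have e' : (denq a)%:~R * (ratr a : C) = (numq a)%:~R.
  by rewrite -(ratr_int C (denq a)) -rmorphM e; exact: ratr_int.
apply: (scalerI d0); rewrite scalerA e' !scaler_int -raddfMz.
by rewrite -[(a *: x) *~ _]scaler_int scalerA e scaler_int raddfMz.
Qed.

Lemma CM_dim_gt0 : (0 < g)%N.
Proof. by have := adim_gt0 {:K}; rewrite dimK; case: g. Qed.

Variables (Lam : set V) (b : 'I_(2 * g) -> V).
Hypothesis hb : lattice_basis b Lam.
Hypothesis J_lattice : forall r v, OK r -> Lam v -> Lam (J r *m v).

Lemma lattice_rat_free (c : 'I_(2 * g) -> rat) :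
  \sum_i (ratr (c i) : C) *: b i = 0 -> forall i, c i = 0.
Proof.
under eq_bigr do rewrite ratr_complex.
case: hb => h _ /h {}h i; have := h i.
by move/eqP; rewrite fmorph_eq0 => /eqP.
Qed.

Lemma lattice_basis_neq0 i : b i != 0.
Proof.
apply/eqP => bi; have h : \sum_j (ratr ((j == i)%:R : rat) : C) *: b j = 0.
  rewrite (bigD1 i) //= bi scaler0 add0r big1 // => j /negPf ->.
  by rewrite rmorph0 scale0r.
by have := lattice_rat_free h i; rewrite eqxx => /eqP; rewrite oner_eq0.
Qed.

Lemma lattice_mem_basis i : Lam (b i).
Proof.
case: hb => _ ->; exists (fun j => (j == i)%:R).
rewrite (bigD1 i) //= eqxx scale1r big1 ?addr0 // => j /negPf ->.
by rewrite scale0r.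
Qed.

Lemma lattice_rat_coordinates x v : Lam v ->
  exists c : 'I_(2 * g) -> rat, J x *m v = \sum_i (ratr (c i) : C) *: b i.
Proof.
move=> hv; have [N N0 hN] := clear_denominator x.
have := J_lattice hN hv; case: (hb) => _ -> [m hm].
exists (fun i => N%:R^-1 * (m i)%:~R).
have n0 : (N%:R : C) != 0 by rewrite pnatr_eq0 -lt0n.
have eN : (N%:R : C) *: (J x *m v) = J (N%:R * x) *m v.
  by rewrite [N%:R * x]mulr_natl raddfMn scalemxAl scaler_nat.
apply: (scalerI n0); rewrite eN hm scaler_sumr; apply: eq_bigr => i _.
by rewrite scalerA rmorphM fmorphV rmorph_nat rmorph_int mulVKf.
Qed.

(** The map from x to J(x) v0 is injective because J(x) is invertible for nonzero x; in rational
    coordinates it is a square matrix F, hence also surjective. *)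
Lemma cyclic_basis v0 : Lam v0 -> v0 != 0 ->
  exists beta : 'I_(2 * g) -> K, forall j, J (beta j) *m v0 = b j.
Proof.
move=> hv0 v00; have [c hc] := choice (fun x => lattice_rat_coordinates x hv0).
pose e := vbasis {:K}; have be : basis_of {:K} e := vbasisP _.
pose F : 'M[rat]_(\dim {:K}, 2 * g) := \matrix_(k, i) c e`_k i.
have hF (a : 'rV[rat]_(\dim {:K})) :
    J (\sum_k a 0 k *: e`_k) *m v0 = \sum_i (ratr ((a *m F) 0 i) : C) *: b i.
  rewrite rmorph_sum mulmx_suml.
  under eq_bigr do rewrite rmorph_ratZ -scalemxAl hc scaler_sumr.
  rewrite exchange_big /=; apply: eq_bigr => i _.
  rewrite mxE rmorph_sum scaler_suml; apply: eq_bigr => k _.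
  by rewrite scalerA mxE rmorphM.
have Ffree : row_free F.
  apply: inj_row_free => a ha.
  have h0 : J (\sum_k a 0 k *: e`_k) *m v0 = 0.
    rewrite hF ha big1 // => i _.
    by rewrite mxE rmorph0 scale0r.
  have x0 : \sum_k a 0 k *: e`_k = 0.
    apply/eqP/negPn/negP => x0; case/eqP: v00.
    rewrite -[v0]mul1mx -[1%:M]/(1 : 'M[C]_g) -(rmorph1 J) -(mulVf x0) rmorphM.
    by rewrite -[_ * _]/(_ *m _) -mulmxA h0 mulmx0.
  apply/rowP => k; rewrite mxE; move/freeP: (basis_free be) => /(_ (fun k => a 0 k)).
  exact.
have Ffull : row_full F.
  by rewrite /row_full; move: Ffree; rewrite /row_free => /eqP ->; rewrite dimK.
have /choice [beta hbeta] : forall j, exists x, J x *m v0 = b j.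
  move=> j; have /submxP [a ha] : ((delta_mx 0 j : 'rV[rat]_(2 * g)) <= F)%MS by exact: submx_full.
  exists (\sum_k a 0 k *: e`_k); rewrite hF -ha (bigD1 j) //= mxE !eqxx rmorph1 scale1r.
  rewrite big1 ?addr0 // => i /negPf ij.
  by rewrite mxE ij andbF rmorph0 scale0r.
by exists beta.
Qed.

End CyclicBasis.

(** * Primitive elements and simultaneous diagonalization *)

Lemma number_field_generator (K : fieldExtType rat) :
  exists (t : K) (q : {poly rat}),
    [/\ size q = (\dim {:K}).+1, root (map_poly (in_alg K) q) t, separable_poly q
      & forall x : K, exists p : {poly rat}, x = (map_poly (in_alg K) p).[t]].
Proof.
have c0 : has_pchar0 K.
  move=> p; apply/negP; rewrite inE => /andP [/prime_gt0 p0 /eqP h].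
  by have := natr_ext_neq0 K p0; rewrite h eqxx.
have sep : separable (1%AS : {subfield K}) {:K}.
  by apply/separableP => x _; exact: pcharf0_separable.
set t := separable_generator (1%AS : {subfield K}) {:K}%AS.
have et : <<1%AS; t>>%VS = fullv :> {vspace K}.
  by rewrite -(eq_adjoin_separable_generator sep) // sub1v.
have /polyOver1P [q hq] := minPolyOver (1%AS : {subfield K}) t.
exists t, q; split.
- rewrite -(size_map_poly (in_alg K)) -hq size_minPoly.
  by have := dim_Fadjoin (1%AS : {subfield K}) t; rewrite et dimv1 muln1 => <-.
- by rewrite -hq; exact: root_minPoly.
- by rewrite -(separable_map (in_alg K)) -hq; exact: pcharf0_separable.
move=> x; have xt : x \in <<1%AS; t>>%VS by rewrite et memvf.
have /polyOver1P [p hp] := Fadjoin_polyOver (1%AS : {subfield K}) t x.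
by exists p; rewrite -hp Fadjoin_poly_eq.
Qed.

Lemma rmorph_horner_alg (K : fieldExtType rat) (F : numFieldType) (f : {rmorphism K -> F})
    (p : {poly rat}) t : f (map_poly (in_alg K) p).[t] = (map_poly ratr p).[f t].
Proof.
rewrite -horner_map -map_poly_comp; congr (_.[_]); apply: eq_map_poly => a /=.
by rewrite alg_num_field fmorph_rat.
Qed.

(** The polynomial q kills J(t) and has simple roots in the complex numbers, so J(t) is
    diagonalizable; every J(x) is a polynomial in J(t) and is diagonal in the same basis. The
    diagonal entries inherit multiplicativity from J. *)
Lemma diagonalize_representation (R : realType) (g : nat) (K : fieldExtType rat)
    (J : {rmorphism K -> 'M[R[i]]_g}) : (0 < g)%N ->
  exists (M : 'M[R[i]]_g) (phi : 'I_g -> {rmorphism K -> R[i]}),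
    M \in unitmx /\ forall x, M *m J x = diag_mx (\row_i phi i x) *m M.
Proof.
case: g J => // n J _; have [t [q [qsz qt qsep hp]]] := number_field_generator K.
have hJ p : J (map_poly (in_alg K) p).[t] = horner_mx (J t) (map_poly ratr p).
  rewrite -horner_map -map_poly_comp /horner_mx /horner_morph -map_poly_comp.
  congr (_.[_]); apply: eq_map_poly => a /=.
  by rewrite (rmorph_ratZ J) rmorph1 -[1]/(1%:M) scale_scalar_mx mulr1.
pose Q : {poly R[i]} := map_poly ratr q.
have [rs hrs] := closed_field_poly_normal Q.
have Qsep : separable_poly Q by rewrite separable_map.
have Q0 : Q != 0 by rewrite map_poly_eq0 -size_poly_eq0 qsz.
have l0 : lead_coef Q != 0 by rewrite lead_coef_eq0.
have urs : uniq rs.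
  by rewrite -separable_prod_XsubC -(eqp_separable (eqp_scale _ l0)) -hrs.
have hmin : mxminpoly (J t) %| \prod_(z <- rs) ('X - z%:P).
  apply: (@dvdp_trans _ Q); last by rewrite {1}hrs dvdpZl.
  apply: mxminpoly_min; rewrite -hJ (_ : _.[t] = 0) ?rmorph0 //.
  exact/eqP.
have [M uM /similar_diagPex [D hD]] : diagonalizable (J t).
  by apply/diagonalizableP; exists rs.
have hM x : exists d : 'rV_n.+1, M *m J x = diag_mx d *m M.
  have [p ->] := hp x; exists (map_mx (horner (map_poly ratr p)) D).
  rewrite hJ -horner_mx_diag.
  have <- : M *m J t *m invmx M = diag_mx D.
    by move/(similarP uM): hD => ->; rewrite mulmxK.
  by rewrite horner_mx_uconj // mulmxKV.
have [d hd] := choice hM.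
have dinj (u v : 'rV[R[i]]_n.+1) : diag_mx u *m M = diag_mx v *m M -> u = v.
  move/(can_inj (mulmxK uM)) => /matrixP h; apply/rowP => i.
  by have := h i i; rewrite !mxE eqxx !mulr1n.
pose f i x := d x 0 i.
have fB i : zmod_morphism (f i).
  move=> x y; rewrite /f; suff -> : d (x - y) = d x - d y by rewrite !mxE.
  by apply: dinj; rewrite -hd rmorphB mulmxBr !hd -mulmxBl -raddfB.
have fM i : monoid_morphism (f i).
  split.
    rewrite /f; suff -> : d 1 = const_mx 1 by rewrite mxE.
    apply: dinj; rewrite -hd rmorph1 diag_const_mx mul1mx.
    by rewrite -[1]/(1%:M) mulmx1.
  move=> x y; rewrite /f.
  suff -> : d (x * y) = \row_k (d x 0 k * d y 0 k) by rewrite !mxE.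
  apply: dinj; rewrite -hd rmorphM -[_ * _]/(_ *m _) mulmxA hd -mulmxA hd mulmxA.
  congr (_ *m _); apply/matrixP => k l; rewrite mul_diag_mx !mxE.
  by rewrite mulrnAr.
pose phi i : {rmorphism K -> R[i]} :=
  HB.pack (f i) (GRing.isZmodMorphism.Build _ _ (f i) (fB i))
    (GRing.isMonoidMorphism.Build _ _ (f i) (fM i)).
exists M, phi; split; first exact: uM.
move=> x; rewrite hd; congr (diag_mx _ *m _).
by apply/rowP => i; rewrite mxE.
Qed.

(** * Riemann forms and their transport along linear isomorphisms *)

Section PolAVTheory.
Variables (R : realType) (g : nat).
Local Notation C := R[i].
Local Notation V := 'cV[C]_g.

Section Form.
Variable A : polAV R g.
Local Notation E := (rform A).

Lemma rformDl u v w : E (u + v) w = E u w + E v w.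
Proof. by have := form_linear A 1 u v w; rewrite scale1r mul1r. Qed.
Lemma rform0l w : E 0 w = 0.
Proof.
have := rformDl 0 0 w; rewrite addr0 => h.
by apply: (addrI (E 0 w)); rewrite -h addr0.
Qed.
Lemma rformZl t u w : E (t%:C *: u) w = t * E u w.
Proof. by have := form_linear A t u 0 w; rewrite addr0 rform0l addr0. Qed.
Lemma rformDr u v w : E w (u + v) = E w u + E w v.
Proof. by rewrite !(form_skew A _ w) rformDl opprD. Qed.
Lemma rformZr t u w : E w (t%:C *: u) = t * E w u.
Proof. by rewrite !(form_skew A _ w) rformZl mulrN. Qed.
Lemma rformNr u w : E w (- u) = - E w u.
Proof. by have := rformZr (-1) u w; rewrite rmorphN1 scaleN1r mulN1r. Qed.
Lemma rform0r w : E w 0 = 0.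
Proof. by rewrite (form_skew A _ w) rform0l oppr0. Qed.
Lemma rform_self u : E u u = 0.
Proof.
have := form_skew A u u; lra.
Qed.
Lemma rform_suml n (t : 'I_n -> R) (b : 'I_n -> V) w :
  E (\sum_i (t i)%:C *: b i) w = \sum_i t i * E (b i) w.
Proof.
elim/big_rec2: _ => [|i y1 y2 _ <-]; first exact: rform0l.
by rewrite rformDl rformZl.
Qed.
Lemma rform_sumr n (t : 'I_n -> R) (b : 'I_n -> V) w :
  E w (\sum_i (t i)%:C *: b i) = \sum_i t i * E w (b i).
Proof.
elim/big_rec2: _ => [|i y1 y2 _ <-]; first exact: rform0r.
by rewrite rformDr rformZr.
Qed.
Lemma rform_nondeg u : (forall v, E u v = 0) -> u = 0.
Proof.
move=> h; apply/eqP/negPn/negP => u0; have := form_pos A u0.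
by rewrite h ltxx.
Qed.
Lemma rform_il u v : E ('i%C *: u) v = - E u ('i%C *: v).
Proof.
have := form_i A u ('i%C *: v); rewrite scalerA => <-.
by rewrite -expr2 sqr_i scaleN1r rformNr opprK.
Qed.

End Form.

Lemma lattice_basis_image (M : 'M[C]_g) n (b : 'I_n -> V) Lam : M \in unitmx ->
  lattice_basis b Lam ->
  lattice_basis (fun i => M *m b i) [set M *m v | v in Lam].
Proof.
move=> uM [hfree ->]; split.
  move=> t ht; apply: hfree; apply: (can_inj (mulKmx uM)); rewrite mulmx0 -[RHS]ht.
  by rewrite mulmx_sumr; apply: eq_bigr => i _; rewrite scalemxAr.
apply/seteqP; split=> [_ [_ [m ->] <-]|_ [m ->]].
  by exists m; rewrite mulmx_sumr; apply: eq_bigr => i _; rewrite scalemxAr.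
exists (\sum_i (m i)%:~R *: b i); first by exists m.
by rewrite mulmx_sumr; apply: eq_bigr => i _; rewrite scalemxAr.
Qed.

Lemma polAV_transport (A : polAV R g) (M : 'M[C]_g) : M \in unitmx ->
  exists B : polAV R g, lat B = [set M *m v | v in lat A] /\
    forall u v, rform B (M *m u) (M *m v) = rform A u v.
Proof.
move=> uM; pose E u v := rform A (invmx M *m u) (invmx M *m v).
have h1 : exists b : 'I_(2 * g) -> V, lattice_basis b [set M *m v | v in lat A].
  have [b hb] := lat_lattice A; exists (fun i => M *m b i).
  exact: lattice_basis_image.
have h2 t u v w : E (t%:C *: u + v) w = t * E u w + E v w.
  by rewrite /E mulmxDr -scalemxAr form_linear.
have h3 u v : E v u = - E u v by rewrite /E form_skew.
have h4 u v : [set M *m v | v in lat A] u -> [set M *m v | v in lat A] v ->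
    E u v \is a Num.int.
  by case=> u' hu <- [v' hv <-]; rewrite /E !mulKmx //; exact: form_int.
have h5 u v : E ('i%C *: u) ('i%C *: v) = E u v by rewrite /E -!scalemxAr form_i.
have h6 u : u != 0 -> 0 < E u ('i%C *: u).
  move=> u0; rewrite /E -scalemxAr; apply: form_pos; apply: contraNneq u0 => h.
  by rewrite -(mulKVmx uM u) h mulmx0.
exists (PolAV h1 h2 h3 h4 h5 h6); split=> //= u v.
by rewrite /E !mulKmx.
Qed.

End PolAVTheory.

(** * Adjoints for the Riemann form *)

Section Rosati.
Variables (R : realType) (g : nat) (K : fieldExtType rat).
Local Notation C := R[i].
Local Notation V := 'cV[C]_g.
Local Notation OK := (ring_of_integers K).
Variable J : {rmorphism K -> 'M[C]_g}.
Hypothesis dimK : \dim {:K} = (2 * g)%N.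
Variables (A : polAV R g) (b : 'I_(2 * g) -> V).
Hypothesis hb : lattice_basis b (lat A).
Hypothesis J_lattice : forall r v, OK r -> lat A v -> lat A (J r *m v).
Local Notation E := (rform A).

Let real_coord := real_coordinates (proj1 hb).

Lemma gram_unitmx : (\matrix_(i, j) E (b i) (b j)) \in unitmx.
Proof.
rewrite -row_free_unit; apply: inj_row_free => t ht.
have h : \sum_i (t 0 i)%:C *: b i = 0.
  apply: (@rform_nondeg _ _ A) => v; have [s ->] := real_coord v.
  rewrite rform_sumr big1 // => j _.
  have -> : E (\sum_i (t 0 i)%:C *: b i) (b j) =
      (t *m \matrix_(i, j) E (b i) (b j)) 0 j.
    by rewrite rform_suml mxE; apply: eq_bigr => i _; rewrite mxE.
  by rewrite ht mxE mulr0.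
by apply/rowP => i; rewrite mxE; case: hb => /(_ _ h).
Qed.

Lemma form_eq_basis u v : (forall i, E (b i) u = E (b i) v) -> u = v.
Proof.
move=> h; apply/eqP; rewrite -subr_eq0; apply/eqP; apply: (@rform_nondeg _ _ A) => w.
rewrite form_skew; have [s ->] := real_coord w.
rewrite rform_suml big1 ?oppr0 // => i _.
by rewrite rformDr rformNr h subrr mulr0.
Qed.

Lemma riesz (l : 'I_(2 * g) -> R) : exists w, forall i, E (b i) w = l i.
Proof.
pose G := \matrix_(i, j) E (b i) (b j); have uG : G \in unitmx := gram_unitmx.
pose t := invmx G *m \col_i l i; exists (\sum_i (t i 0)%:C *: b i) => i.
rewrite rform_sumr; transitivity ((G *m t) i 0).
  by rewrite mxE; apply: eq_bigr => j _; rewrite [G i j]mxE mulrC.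
by rewrite mulKVmx // mxE.
Qed.

Lemma complex_split (z : C) : z = (complex.Re z)%:C + (complex.Im z)%:C * 'i%C.
Proof. by apply: complex_eqP; case: z => x y /=; ring. Qed.

(** Nondegeneracy gives a representing vector for each v. As E(iu,v) = -E(u,iv), representing
    vectors scale with complex scalars, so those of the standard basis are the columns of a complex
    matrix. *)
Lemma adjoint_exists (X : 'M[C]_g) :
  exists Y : 'M[C]_g, forall u v, E (X *m u) v = E u (Y *m v).
Proof.
have hw v : exists w, forall u, E (X *m u) v = E u w.
  have [w hw] := riesz (fun i => E (X *m b i) v); exists w => u.
  have [t ->] := real_coord u; rewrite mulmx_sumr.
  under eq_bigr do rewrite -scalemxAr.
  by rewrite !rform_suml; apply: eq_bigr => i _; rewrite hw.
have hi v w : (forall u, E (X *m u) v = E u w) ->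
    forall u, E (X *m u) ('i%C *: v) = E u ('i%C *: w).
  move=> h u; rewrite -[LHS]opprK -rform_il -[RHS]opprK -rform_il.
  by rewrite scalemxAr h.
have hZ z v w : (forall u, E (X *m u) v = E u w) ->
    forall u, E (X *m u) (z *: v) = E u (z *: w).
  move=> h u; rewrite (complex_split z) !scalerDl -!scalerA !rformDr !rformZr h.
  by rewrite (hi v w h).
have [w hw'] := choice (fun j : 'I_g => hw (delta_mx j 0)).
exists (\matrix_(i, j) w j i 0) => u v.
have -> : v = \sum_j v j 0 *: delta_mx j 0.
  rewrite {1}(matrix_sum_delta v); apply: eq_bigr => j _.
  by rewrite big_ord1.
rewrite mulmx_sumr.
elim/big_rec2: _ => [|j y1 y2 _ ih]; first by rewrite !rform0r.
rewrite !rformDr ih; congr (_ + _).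
rewrite -scalemxAr -colE; apply: hZ => u'; rewrite hw'; congr (E _ _).
by apply/colP => i; rewrite !mxE.
Qed.

Lemma rational_form_coordinates (w : V) :
  (forall i, exists q : rat, E (b i) w = ratr q) ->
  exists c : 'I_(2 * g) -> rat, w = \sum_i (ratr (c i) : C) *: b i.
Proof.
move=> /choice [q hq].
have /choice [m hm] : forall p : 'I_(2 * g) * 'I_(2 * g),
    exists m : int, E (b p.1) (b p.2) = m%:~R.
  by move=> p; apply/intrP; apply: form_int; exact: (lattice_mem_basis hb).
pose Gq : 'M[rat]_(2 * g) := \matrix_(i, j) (m (i, j))%:~R.
have eG : map_mx ratr Gq = \matrix_(i, j) E (b i) (b j).
  by apply/matrixP => i j; rewrite !mxE rmorph_int; have /= -> := hm (i, j).
have uG : Gq \in unitmx by rewrite -(map_unitmx (ratr : rat -> R)) eG gram_unitmx.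
pose t := invmx Gq *m \col_i q i; exists (fun i => t i 0).
apply: form_eq_basis => i; under eq_bigr do rewrite ratr_complex.
rewrite rform_sumr hq.
transitivity (ratr ((Gq *m t) i 0) : R); first by rewrite mulKVmx // mxE.
rewrite mxE rmorph_sum; apply: eq_bigr => j _.
by rewrite rmorphM mulrC [Gq i j]mxE rmorph_int; have /= -> := hm (i, j).
Qed.

(** In lattice coordinates D is a rational matrix; its real kernel is spanned by its rational
    kernel, whose vectors become lattice points after clearing denominators. *)
Lemma rational_kernel_subtorus (D : 'M[C]_g) :
  (forall j, exists c : 'I_(2 * g) -> rat, D *m b j = \sum_i (ratr (c i) : C) *: b i) ->
  subtorus A [set v | D *m v = 0].
Proof.
move=> /choice [c hc]; split.
  split=> [|t u v /= hu hv]; first exact: mulmx0.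
  by rewrite mulmxDr -scalemxAr hu hv scaler0 addr0.
move=> w /= hw; have [t ht] := real_coord w.
pose D' : 'M[rat]_(2 * g) := \matrix_(j, i) c j i.
have hD (a : 'rV[R]_(2 * g)) : D *m (\sum_j (a 0 j)%:C *: b j) =
    \sum_i ((a *m map_mx ratr D') 0 i)%:C *: b i.
  rewrite mulmx_sumr; under eq_bigr do rewrite -scalemxAr hc scaler_sumr.
  rewrite exchange_big /=; apply: eq_bigr => i _.
  rewrite mxE rmorph_sum scaler_suml; apply: eq_bigr => j _.
  by rewrite scalerA !mxE rmorphM ratr_complex.
have tD : (\row_j t j) *m map_mx ratr D' = 0.
  apply/rowP => i; rewrite [RHS]mxE; case: (hb) => hfree _; move: i; apply: hfree.
  rewrite -hD -[RHS]hw ht; congr (_ *m _); apply: eq_bigr => j _.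
  by rewrite mxE.
have : (\row_j t j <= map_mx ratr (kermx D'))%MS by rewrite map_kermx; exact/sub_kermxP.
case/submxP => s hs.
pose k l := \sum_j (ratr (kermx D' l j) : C) *: b j.
have Dk l : D *m k l = 0.
  pose a : 'rV[R]_(2 * g) := map_mx ratr (row l (kermx D')).
  have -> : k l = \sum_j (a 0 j)%:C *: b j.
    by apply: eq_bigr => j _; rewrite ratr_complex !mxE.
  rewrite hD -map_mxM -row_mul mulmx_ker big1 // => i _.
  by rewrite !mxE rmorph0 scale0r.
have /choice [N hN] : forall l, exists N : nat, (0 < N)%N /\ lat A (N%:R *: k l).
  move=> l; have [N [N0 [m hm]]] := common_denominator (fun j => kermx D' l j).
  exists N; split=> //; case: (hb) => _ ->; exists m.
  rewrite scaler_sumr; apply: eq_bigr => j _.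
  by rewrite scalerA -(ratr_int C) -hm rmorphM rmorph_nat.
exists (2 * g)%N, (fun l => s 0 l / (N l)%:R), (fun l => (N l)%:R *: k l); split.
  by move=> l; case: (hN l) => N0 h; split=> //=; rewrite -scalemxAr Dk scaler0.
have ew : w = \sum_l (s 0 l)%:C *: k l.
  rewrite ht.
  under eq_bigr => j _.
    rewrite (_ : t j = (\row_j t j) 0 j); last by rewrite mxE.
    rewrite hs mxE rmorph_sum scaler_suml; over.
  rewrite exchange_big /=; apply: eq_bigr => l _; rewrite scaler_sumr.
  by apply: eq_bigr => j _; rewrite scalerA mxE ratr_complex rmorphM.
rewrite {1}ew; apply: eq_bigr => l _; case: (hN l) => N0 _.
have n0 : ((N l)%:R : C) != 0 by rewrite pnatr_eq0 -lt0n.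
by rewrite scalerA rmorphM fmorphV rmorph_nat divfK.
Qed.

Lemma simple_adjoint x : simple_AV A ->
  exists y, forall u v, E (J x *m u) v = E u (J y *m v).
Proof.
move=> [g0 hs]; have [Y hY] := adjoint_exists (J x).
have gg : (0 < 2 * g)%N by rewrite muln_gt0.
pose v0 := b (Ordinal gg).
have v00 : v0 != 0 := lattice_basis_neq0 hb _.
have hv0 : lat A v0 := lattice_mem_basis hb _.
have [beta hbeta] := cyclic_basis dimK hb J_lattice hv0 v00.
have rat_form i j y : exists q : rat, E (J y *m b i) (b j) = ratr q.
  have [c ->] := lattice_rat_coordinates hb J_lattice y (lattice_mem_basis hb i).
  have /choice [m hm] : forall l, exists m : int, E (b l) (b j) = m%:~R.
    by move=> l; apply/intrP; apply: form_int; exact: (lattice_mem_basis hb).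
  exists (\sum_l c l * (m l)%:~R); under eq_bigr do rewrite ratr_complex.
  rewrite rform_suml rmorph_sum; apply: eq_bigr => l _.
  by rewrite hm rmorphM rmorph_int.
(* Y preserves the rational span of the lattice because E(b_i, Y b_j) = E(J(x) b_i, b_j) is rational
   and the Gram matrix is invertible over the rationals. *)
have Yb j : exists c : 'I_(2 * g) -> rat, Y *m b j = \sum_i (ratr (c i) : C) *: b i.
  apply: rational_form_coordinates => i.
  by have [q hq] := rat_form i j x; exists q; rewrite -hY.
have [c hc] := Yb (Ordinal gg).
pose k := \sum_i c i *: beta i.
have Yv0 : Y *m v0 = J k *m v0.
  rewrite hc rmorph_sum mulmx_suml; apply: eq_bigr => i _.
  by rewrite rmorph_ratZ -scalemxAl hbeta.
exists k => u v; rewrite hY; congr (E _ _).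
have hD : subtorus A [set v | (Y - J k) *m v = 0].
  apply: rational_kernel_subtorus => j; have [d hd] := Yb j.
  have [e he] := lattice_rat_coordinates hb J_lattice k (lattice_mem_basis hb j).
  exists (fun i => d i - e i); rewrite mulmxBl hd he -sumrB; apply: eq_bigr => i _.
  by rewrite rmorphB scalerBl.
have hv : [set v | (Y - J k) *m v = 0] v0 by rewrite /= mulmxBl Yv0 subrr.
case: (hs _ hD) => eW; first by case/eqP: v00; move: hv; rewrite eW.
have : [set v | (Y - J k) *m v = 0] v by rewrite eW.
by rewrite /= mulmxBl => /eqP; rewrite subr_eq0 => /eqP.
Qed.

Lemma stable_adjoint (iota : K -> 'M[C]_g) x :
  (forall y, OK y -> J y = iota y) -> rosati_stable A iota ->
  exists y, forall u v, E (J x *m u) v = E u (J y *m v).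
Proof.
move=> hJ hs; have [N N0 hN] := clear_denominator x.
have [y hy h] := hs _ hN; exists (N%:R^-1 * y) => u v.
have nK : (N%:R : K) != 0 := natr_ext_neq0 K N0.
have n0 : (N%:R : R) != 0 by rewrite pnatr_eq0 -lt0n.
have eZ z w : J (N%:R * z) *m w = (N%:R : R)%:C *: (J z *m w).
  by rewrite [N%:R * z]mulr_natl raddfMn scalemxAl rmorph_nat scaler_nat.
apply: (mulfI n0); rewrite -rformZl -rformZr -!eZ mulVKf // !hJ //.
Qed.

End Rosati.

(** * Coordinates of eigenvectors *)

Lemma embeddingZ (R : realType) (K : fieldExtType rat) (f : {rmorphism K -> R[i]}) a x :
  f (a *: x) = ratr a * f x.
Proof. by rewrite -mulr_algl rmorphM alg_num_field fmorph_rat. Qed.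

Lemma conjcM (R : realType) (z w : R[i]) : conjc (z * w) = conjc z * conjc w.
Proof. exact: rmorphM. Qed.

Lemma conjcB (R : realType) (z w : R[i]) : conjc (z - w) = conjc z - conjc w.
Proof. exact: rmorphB. Qed.

Lemma conjc_sum (R : realType) (I : finType) (z : I -> R[i]) :
  conjc (\sum_i z i) = \sum_i conjc (z i).
Proof. exact: rmorph_sum. Qed.

Section StandardForm.
Variables (R : realType) (g : nat) (K : fieldExtType rat) (K0 : {subfield K}).
Local Notation C := R[i].
Local Notation V := 'cV[C]_g.
Local Notation OK := (ring_of_integers K).
Hypothesis hK : CM_field R g K0.
Variable phi : 'I_g -> {rmorphism K -> C}.
Local Notation Phi := (Phi_vec (fun i => phi i : K -> C)).
Variables (B : polAV R g) (beta : 'I_(2 * g) -> K).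
Hypothesis hbeta : lattice_basis (fun j => Phi (beta j)) (lat B).
Local Notation E := (rform B).
Local Notation dg := (fun x => diag_mx (\row_i phi i x)).

Lemma CM_dim : \dim {:K} = (2 * g)%N. Proof. by case: hK. Qed.

Lemma dg_scale x i (z : C) : dg x *m (z *: delta_mx i 0) =
  (phi i x * z) *: delta_mx i 0 :> V.
Proof.
apply/colP => k; rewrite mul_diag_mx !mxE.
by have [->|_] := eqVneq k i; rewrite ?mulr1 ?mulr0.
Qed.

Lemma dg_Phi x y : dg x *m Phi y = Phi (x * y).
Proof. by apply/colP => k; rewrite mul_diag_mx !mxE rmorphM. Qed.

Lemma Phi_coord (v : V) : exists t : 'I_(2 * g) -> R,
  forall i, v i 0 = \sum_k (t k)%:C * phi i (beta k).
Proof.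
have [t ->] := real_coordinates (proj1 hbeta) v; exists t => i.
by rewrite summxE; apply: eq_bigr => k _; rewrite !mxE.
Qed.

(** Real combinations of the Phi(beta k) fill C^g, while phi_i = phi_j would force v_i = v_j for all
    of them. *)
Lemma phi_separated i j : i != j -> ~ (forall x, phi i x = phi j x).
Proof.
move=> ij h; have [t ht] := Phi_coord (delta_mx i 0).
have e : (delta_mx i 0 : V) i 0 = (delta_mx i 0 : V) j 0.
  by rewrite !ht; apply: eq_bigr => k _; rewrite h.
by move/eqP: e; rewrite !mxE !eqxx [j == i]eq_sym (negPf ij) oner_eq0.
Qed.

(** For i different from j the forced relation v_i = conj(v_j) is still real-linear and fails on
    C^g; for i = j, phi_i would be real, and K is totally imaginary. *)
Lemma phi_conj_separated i j : ~ (forall x, phi i x = conjc (phi j x)).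
Proof.
have [->|ij] := eqVneq i j => h.
  case: hK => _ _ _ /(_ (phi j)) [x]; have := h x.
  by case: (phi j x) => a b [] /= hb; rewrite (_ : b = 0) ?eqxx //; lra.
have [t ht] := Phi_coord (delta_mx i 0).
have e : (delta_mx i 0 : V) i 0 = conjc ((delta_mx i 0 : V) j 0).
  rewrite !ht conjc_sum; apply: eq_bigr => k _.
  by rewrite h conjcM conjc_real.
have ej : (delta_mx i 0 : V) j 0 = 0 by rewrite mxE [j == i]eq_sym (negPf ij).
by move/eqP: e; rewrite ej conjc0 mxE !eqxx oner_eq0.
Qed.

Lemma embedding_eq (t : K) :
  (forall x : K, exists p : {poly rat}, x = (map_poly (in_alg K) p).[t]) ->
  forall f f' : {rmorphism K -> C}, f t = f' t -> forall x, f x = f' x.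
Proof. by move=> hp f f' e x; have [p ->] := hp x; rewrite !rmorph_horner_alg e. Qed.

(** The phi_i and their conjugates already give 2g distinct roots of q, which has degree 2g; another
    embedding would give one root too many. *)
Lemma phi_conj_exhaust (psi : {rmorphism K -> C}) :
  exists i, (forall x, psi x = phi i x) \/ (forall x, psi x = conjc (phi i x)).
Proof.
have [t [q [qsz qt qsep hp]]] := number_field_generator K.
pose cphi i : {rmorphism K -> C} := (conjc : C -> C) \o phi i.
have ext f f' := @embedding_eq t hp f f'.
pose s1 := [seq phi i t | i : 'I_g]; pose s2 := [seq cphi i t | i : 'I_g].
have u1 : uniq s1.
  rewrite map_inj_in_uniq ?enum_uniq // => i j _ _ e.
  apply/eqP/negPn/negP => ij; apply: (phi_separated ij).
  exact: ext.
have u2 : uniq s2.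
  rewrite map_inj_in_uniq ?enum_uniq // => i j _ _ e.
  apply/eqP/negPn/negP => ij; apply: (phi_separated ij); apply: ext.
  exact: (can_inj (@conjcK _)).
have u12 : uniq (s1 ++ s2).
  rewrite cat_uniq u1 u2 andbT /=; apply/hasPn => z /mapP [j _ ->].
  apply/negP => /mapP [i _ e]; apply: (@phi_conj_separated i j).
  by move=> x; rewrite (ext (phi i) (cphi j)).
have [|h] := boolP (psi t \in s1 ++ s2).
  rewrite mem_cat => /orP [] /mapP [i _ e]; exists i.
    by left; exact: ext.
  by right=> x; rewrite (ext psi (cphi i)).
have rt (f : {rmorphism K -> C}) : root (map_poly ratr q) (f t).
  by rewrite /root -rmorph_horner_alg (eqP qt) rmorph0.
have := @max_poly_roots _ (map_poly (ratr : rat -> C) q) (psi t :: s1 ++ s2).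
rewrite map_poly_eq0 -size_poly_eq0 qsz size_map_poly qsz /= h u12 rt /=.
rewrite size_cat !size_map -enumT size_enum_ord CM_dim => /(_ isT).
have -> : all (root (map_poly (ratr : rat -> C) q)) (s1 ++ s2).
  by rewrite all_cat; apply/andP; split; apply/allP => _ /mapP [i _ ->]; exact: rt.
by move=> /(_ isT isT); lia.
Qed.

Lemma adjoint_conj x y : (forall u v, E (dg x *m u) v = E u (dg y *m v)) ->
  forall i, phi i y = conjc (phi i x).
Proof.
move=> hy i.
pose w : V := delta_mx i 0.
have w0 : w != 0 by apply/eqP => /colP /(_ i)/eqP; rewrite !mxE !eqxx oner_eq0.
have h0 : E w ('i%C *: w) != 0 by rewrite gt_eqF // form_pos.
have hx z : dg x *m (z *: w) = (phi i x * z) *: w := dg_scale x i z.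
have hyz z : dg y *m (z *: w) = (phi i y * z) *: w := dg_scale y i z.
have l1 z v : E (z *: w) v = complex.Re z * E w v - complex.Im z * E w ('i%C *: v).
  by rewrite {1}(complex_split z) scalerDl -scalerA rformDl !rformZl rform_il mulrN.
have l2 z v : E v (z *: w) = complex.Re z * E v w + complex.Im z * E v ('i%C *: w).
  by rewrite {1}(complex_split z) scalerDl -scalerA rformDr !rformZr.
have ii : 'i%C *: ('i%C *: w) = - w by rewrite scalerA -expr2 sqr_i scaleN1r.
have hx1 : dg x *m w = phi i x *: w by rewrite -{1}[w]scale1r hx mulr1.
have hy1 : dg y *m w = phi i y *: w by rewrite -{1}[w]scale1r hyz mulr1.
(* Since E(w,w) = 0 and E(w,iw) is nonzero, testing against iw compares the real parts of the
   eigenvalues and testing against w the imaginary parts. *)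
have e1 := hy w ('i%C *: w); have e2 := hy w w.
rewrite hx1 hyz l1 (l2 (_ * _)) ii rformNr rform_self oppr0 !mulr0 subr0 add0r in e1.
rewrite hx1 hy1 l1 (l2 (phi i y)) rform_self !mulr0 sub0r add0r -mulNr in e2.
apply: complex_eqP.
  have -> : complex.Re (conjc (phi i x)) = complex.Re (phi i x) by case: (phi i x).
  apply: (mulIf h0); rewrite e1; congr (_ * _).
  by case: (phi i y) => a c /=; ring.
by apply: (mulIf h0); rewrite -e2; case: (phi i x).
Qed.

Hypothesis hros : forall x, exists y, forall u v, E (dg x *m u) v = E u (dg y *m v).

(** The choice made by [cmconj] succeeds because the adjoint of x is a conjugate of x under every
    phi_i, hence under every embedding, these being the phi_i and their conjugates. *)
Lemma cmconj_spec (psi : {rmorphism K -> C}) x : psi (cmconj R x) = conjc (psi x).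
Proof.
have [y /adjoint_conj hy] := hros x.
suff : [set y | forall f : {rmorphism K -> C}, f y = conjc (f x)] (cmconj R x).
  by apply.
apply: xgetPex; exists y => f; have [i [h|h]] := phi_conj_exhaust f.
  by rewrite !h hy.
by rewrite !h hy.
Qed.

Lemma g_pos : (0 < g)%N. Proof. exact: (CM_dim_gt0 CM_dim). Qed.

Lemma cm_conjugation : exists bar : {rmorphism K -> K}, forall x, bar x = cmconj R x.
Proof.
pose f := phi (Ordinal g_pos); have inj : injective f := fmorph_inj f.
have hB : zmod_morphism (@cmconj R K : K -> K).
  by move=> x y; apply: inj; rewrite rmorphB !cmconj_spec rmorphB conjcB.
have hM : monoid_morphism (@cmconj R K : K -> K).
  split; first by apply: inj; rewrite cmconj_spec rmorph1 conjc1.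
  by move=> x y; apply: inj; rewrite rmorphM !cmconj_spec rmorphM conjcM.
pose bar : {rmorphism K -> K} := HB.pack (@cmconj R K : K -> K)
  (GRing.isZmodMorphism.Build _ _ (@cmconj R K : K -> K) hB)
  (GRing.isMonoidMorphism.Build _ _ (@cmconj R K : K -> K) hM).
by exists bar.
Qed.

Variable bar : {rmorphism K -> K}.
Hypothesis hbar : forall x, bar x = cmconj R x.

Lemma embedding_bar (psi : {rmorphism K -> C}) x : psi (bar x) = conjc (psi x).
Proof. by rewrite hbar cmconj_spec. Qed.

Lemma adjoint_bar x u v : E (dg x *m u) v = E u (dg (bar x) *m v).
Proof.
have [y hy] := hros x; rewrite hy; congr (E _ (diag_mx _ *m _)); apply/rowP => i.
by rewrite !mxE embedding_bar (adjoint_conj hy).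
Qed.

Lemma cm_barK x : bar (bar x) = x.
Proof.
apply: (fmorph_inj (phi (Ordinal g_pos))).
by rewrite !embedding_bar conjcK.
Qed.

Lemma cm_bar_nontrivial : exists x, bar x != x.
Proof.
case: hK => _ _ _ /(_ (phi (Ordinal g_pos))) [x hx]; exists x.
apply: contra hx => /eqP e; have := embedding_bar (phi (Ordinal g_pos)) x.
rewrite e; case: (phi _ x) => a b /= [] h; apply/eqP; lra.
Qed.

Lemma cm_bar_vsval (c : subvs_of K0) : bar (vsval c) = vsval c.
Proof.
pose f := phi (Ordinal g_pos); apply: (fmorph_inj f).
have im0 : complex.Im (f (vsval c)) = 0.
  case: hK => _ _ /(_ (f \o vsval) c) h _; exact: h.
rewrite embedding_bar; move: im0; case: (f _) => a b /= ->.
by rewrite oppr0.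
Qed.

(** For an h with bar h = -h, [bar] is 1 on K0 and -1 on W = K0 h. These spaces meet in 0 and have
    dimension g each, so they fill K and a fixed x has no component in W. *)
Lemma cm_bar_fixed x : bar x = x <-> exists c : subvs_of K0, x = vsval c.
Proof.
split=> [ex|[c ->]]; last exact: cm_bar_vsval.
have [y hy] := cm_bar_nontrivial; pose h := y - bar y.
have h0 : h != 0 by rewrite subr_eq0 eq_sym.
have hh : bar h = - h by rewrite rmorphB cm_barK opprB.
pose W := (amulr h @: K0)%VS.
have mem_fixed z : z \in K0 -> bar z = z.
  by move=> hz; rewrite -[z](@vsprojK _ _ K0) // cm_bar_vsval.
have W0 z : z \in W -> bar z = - z.
  case/memv_imgP => c hc ->; rewrite lfunE /= rmorphM hh mem_fixed // mulrN.
  by [].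
have dW : \dim W = g.
  transitivity (\dim K0); last by case: hK.
  apply: limg_dim_eq; apply/eqP; rewrite -subv0; apply/subvP => z.
  rewrite memv_cap memv_ker lfunE /= mulf_eq0 (negPf h0) orbF => /andP [_ /eqP ->].
  exact: mem0v.
have cap0 : (K0 :&: W)%VS = 0%VS.
  apply/eqP; rewrite -subv0; apply/subvP => z; rewrite memv_cap => /andP [h1 h2].
  have e := W0 z h2; rewrite (mem_fixed z h1) in e.
  have : 2%:R * z == 0 by rewrite mulr_natl mulr2n {1}e addNr.
  by rewrite mulf_eq0 (negPf (natr_ext_neq0 K _)) // => /eqP ->; exact: mem0v.
have full : (K0 + W)%VS = fullv.
  apply/eqP; rewrite eqEdim subvf dimv_disjoint_sum // dW.
  by case: hK => -> -> _ _; rewrite mul2n addnn leqnn.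
have : x \in (K0 + W)%VS by rewrite full memvf.
case/memv_addP => a ha [w hw e].
have : bar x = a - w by rewrite e rmorphD (mem_fixed a ha) (W0 w hw).
rewrite ex e => e2.
have : 2%:R * w == 0.
  by rewrite mulr_natl mulr2n -{1}[w](addKr a) e2 addrA addNr add0r addNr.
rewrite mulf_eq0 (negPf (natr_ext_neq0 K _)) // => /eqP ->.
by rewrite addr0; exists (vsproj K0 a); rewrite vsprojK.
Qed.

End StandardForm.

(** * The trace form *)

Section TraceForm.
Variables (R : realType) (g : nat) (K : fieldExtType rat).
Local Notation C := R[i].
Local Notation V := 'cV[C]_g.
Local Notation OK := (ring_of_integers K).
Hypothesis dimK : \dim {:K} = (2 * g)%N.
Variable phi : 'I_g -> {rmorphism K -> C}.
Local Notation Phi := (Phi_vec (fun i => phi i : K -> C)).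
Variables (B : polAV R g) (beta : 'I_(2 * g) -> K).
Hypothesis hbeta : lattice_basis (fun j => Phi (beta j)) (lat B).
Hypothesis hdet : \det (\matrix_(i, j) rform B (Phi (beta i)) (Phi (beta j))) = 1.
Local Notation E := (rform B).
Local Notation dg := (fun x => diag_mx (\row_i phi i x)).
Variable bar : {rmorphism K -> K}.
Hypothesis phi_bar : forall i x, phi i (bar x) = conjc (phi i x).
Hypothesis barK : forall x, bar (bar x) = x.
Hypothesis hadj : forall x u v, E (dg x *m u) v = E u (dg (bar x) *m v).
Hypothesis hO : forall r x, OK r -> lat B (Phi x) -> lat B (Phi (r * x)).
Let hOK : subring OK := OL_subring K.

Lemma ratr_inj (F : numFieldType) : injective (ratr : rat -> F).
Proof. exact: fmorph_inj. Qed.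

Let i0 : 'I_g := Ordinal (CM_dim_gt0 dimK).

Lemma Phi_inj : injective Phi.
Proof. by move=> x y /colP /(_ i0); rewrite !mxE; exact: fmorph_inj. Qed.

Lemma Phi_sum (c : 'I_(2 * g) -> rat) :
  Phi (\sum_k c k *: beta k) = \sum_k (ratr (c k) : C) *: Phi (beta k).
Proof.
apply/colP => i; rewrite mxE summxE rmorph_sum; apply: eq_bigr => k _.
by rewrite !mxE embeddingZ.
Qed.

Lemma beta_free (c : 'I_(2 * g) -> rat) :
  \sum_k c k *: beta k = 0 -> forall k, c k = 0.
Proof.
move=> h; apply: (lattice_rat_free hbeta); rewrite -Phi_sum h.
by apply/colP => i; rewrite !mxE rmorph0.
Qed.

Lemma beta_span x : exists c : 'I_(2 * g) -> rat, x = \sum_k c k *: beta k.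
Proof.
pose X := [tuple beta k | k < 2 * g].
have Xn (k : 'I_(2 * g)) : X`_k = beta k by rewrite -tnth_nth tnth_mktuple.
have Xfree : free X.
  apply/freeP => c hc; apply: beta_free; rewrite -[RHS]hc.
  by apply: eq_bigr => k _; rewrite Xn.
have Xb : basis_of {:K} X.
  by rewrite basisEfree Xfree subvf size_tuple dimK leqnn.
exists (fun k => coord X k x); rewrite {1}(coord_basis Xb (memvf x)).
by apply: eq_bigr => k _; rewrite Xn.
Qed.

Lemma lat_Phi x : lat B (Phi x) <->
  exists m : 'I_(2 * g) -> int, x = \sum_k (m k)%:~R *: beta k.
Proof.
have e (m : 'I_(2 * g) -> int) :
    Phi (\sum_k (m k)%:~R *: beta k) = \sum_k (m k)%:~R *: Phi (beta k).
  by rewrite Phi_sum; apply: eq_bigr => k _; rewrite rmorph_int.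
case: (hbeta) => _ ->; split=> [[m hm]|[m ->]]; exists m => //.
by apply: Phi_inj; rewrite hm e.
Qed.

(** The matrix P of the phi_i and their conjugates at beta diagonalizes multiplication by x. It is
    invertible: the real and imaginary parts of a relation between its rows are real relations
    between lattice basis vectors. *)
Lemma trace_embeddings x :
  ratr (field_trace x) = \sum_i (phi i x + conjc (phi i x)) :> C.
Proof.
have [a ha] := choice (fun j => beta_span (x * beta j)).
pose A : 'M[rat]_(2 * g) := \matrix_(j, i) a j i.
rewrite (@field_trace_family _ _ beta A); first last.
- by move=> j; rewrite ha; apply: eq_bigr => i _; rewrite mxE.
- exact: beta_span.
- exact: beta_free.
pose P : 'M[C]_(2 * g, g + g) :=
  \matrix_k row_mx (\row_i phi i (beta k)) (\row_i conjc (phi i (beta k))).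
pose d : 'rV[C]_(g + g) := row_mx (\row_i phi i x) (\row_i conjc (phi i x)).
have Pl k i : P k (lshift g i) = phi i (beta k) by rewrite mxE row_mxEl mxE.
have Pr k i : P k (rshift g i) = conjc (phi i (beta k)) by rewrite mxE row_mxEr mxE.
have dl i : d 0 (lshift g i) = phi i x by rewrite /d row_mxEl mxE.
have dr i : d 0 (rshift g i) = conjc (phi i x) by rewrite /d row_mxEr mxE.
have AP : map_mx ratr A *m P = P *m diag_mx d.
  apply/matrixP => k j; rewrite mul_mx_diag [LHS]mxE [RHS]mxE.
  case: (split_ordP j) => i ->.
    rewrite dl Pl mulrC -rmorphM ha rmorph_sum.
    by apply: eq_bigr => l _; rewrite Pl !mxE embeddingZ.
  rewrite dr Pr mulrC -conjcM -rmorphM ha rmorph_sum conjc_sum.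
  by apply: eq_bigr => l _; rewrite Pr !mxE embeddingZ conjcM conj_ratr.
have hfree : forall t : 'I_(2 * g) -> R,
    (forall i, \sum_k (t k)%:C * phi i (beta k) = 0) -> forall k, t k = 0.
  move=> t ht; case: hbeta => h _; apply: h; apply/colP => i.
  rewrite summxE mxE -[RHS](ht i); apply: eq_bigr => k _.
  by rewrite !mxE.
have Pfree : row_free P.
  apply: inj_row_free => t ht.
  have h1 i : \sum_k t 0 k * phi i (beta k) = 0.
    have <- : (t *m P) 0 (lshift g i) = \sum_k t 0 k * phi i (beta k).
      by rewrite mxE; apply: eq_bigr => k _; rewrite Pl.
    by rewrite ht mxE.
  have h2 i : \sum_k conjc (t 0 k) * phi i (beta k) = 0.
    have e : (t *m P) 0 (rshift g i) = conjc (\sum_k conjc (t 0 k) * phi i (beta k)).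
      by rewrite mxE conjc_sum; apply: eq_bigr => k _; rewrite Pr conjcM conjcK.
    by apply: (can_inj (@conjcK _)); rewrite -e ht mxE conjc0.
  have re k : complex.Re (t 0 k) = 0.
    apply: (hfree (fun k => complex.Re (t 0 k))) => i.
    have two : (2%:R : C) != 0 by rewrite pnatr_eq0.
    have e : 2%:R * \sum_k (complex.Re (t 0 k))%:C * phi i (beta k) =
        \sum_k t 0 k * phi i (beta k) + \sum_k conjc (t 0 k) * phi i (beta k).
      rewrite mulr_sumr -big_split; apply: eq_bigr => k' _ /=.
      rewrite -mulrDl mulrA; congr (_ * _).
      by case: (t 0 k') => x1 x2; apply: complex_eqP => /=; ring.
    by apply: (mulfI two); rewrite e h1 h2 mulr0 addr0.
  have im k : complex.Im (t 0 k) = 0.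
    apply: (hfree (fun k => complex.Im (t 0 k))) => i.
    have two : (2%:R * 'i%C : C) != 0 by rewrite mulf_neq0 ?pnatr_eq0 // neq0Ci.
    have e : (2%:R * 'i%C) * \sum_k (complex.Im (t 0 k))%:C * phi i (beta k) =
        \sum_k t 0 k * phi i (beta k) - \sum_k conjc (t 0 k) * phi i (beta k).
      rewrite mulr_sumr -sumrB; apply: eq_bigr => k' _ /=.
      rewrite -mulrBl mulrA; congr (_ * _).
      by case: (t 0 k') => x1 x2; apply: complex_eqP => /=; ring.
    by apply: (mulfI two); rewrite e h1 h2 mulr0 subr0.
  by apply/rowP => k; rewrite mxE; apply: complex_eqP => /=; [exact: re|exact: im].
have Pfull : row_full P.
  by rewrite /row_full; move: Pfree; rewrite /row_free => /eqP ->; rewrite mul2n addnn.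
rewrite -(trace_map_mx (ratr : {rmorphism rat -> C})).
rewrite -[map_mx _ A]mulmx1 -(mulmxVp Pfree) mulmxA AP -mulmxA mxtrace_mulC.
rewrite -mulmxA mulVpmx // mulmx1 mxtrace_diag big_split_ord big_split /=.
by congr (_ + _); apply: eq_bigr => i _; rewrite ?dl ?dr.
Qed.

Lemma form_basis_int : exists G : 'M[int]_(2 * g), \det G = 1 /\
  forall k l, E (Phi (beta k)) (Phi (beta l)) = (G k l)%:~R.
Proof.
have /choice [m hm] : forall p : 'I_(2 * g) * 'I_(2 * g),
    exists m : int, E (Phi (beta p.1)) (Phi (beta p.2)) = m%:~R.
  by move=> p; apply/intrP; apply: form_int; exact: (lattice_mem_basis hbeta).
exists (\matrix_(k, l) m (k, l)); split; last first.
  by move=> k l; rewrite mxE -(hm (k, l)).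
apply: (@intr_inj R); rewrite -det_map_mx rmorph1 -[RHS]hdet; congr (\det _).
by apply/matrixP => k l; rewrite !mxE; exact/esym/(hm (k, l)).
Qed.

Lemma form_sum (c d : 'I_(2 * g) -> rat) (G : 'M[int]_(2 * g)) :
  (forall k l, E (Phi (beta k)) (Phi (beta l)) = (G k l)%:~R) ->
  E (Phi (\sum_k c k *: beta k)) (Phi (\sum_k d k *: beta k)) =
  ratr (\sum_k c k * \sum_l d l * (G k l)%:~R).
Proof.
move=> hG; rewrite !Phi_sum; under eq_bigr do rewrite ratr_complex.
rewrite rform_suml rmorph_sum; apply: eq_bigr => k _.
under eq_bigr do rewrite ratr_complex.
rewrite rform_sumr rmorphM rmorph_sum; congr (_ * _); apply: eq_bigr => l _.
by rewrite hG rmorphM rmorph_int.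
Qed.

Lemma form_rational x y : exists q : rat, E (Phi x) (Phi y) = ratr q.
Proof.
have [G [_ hG]] := form_basis_int.
have [c ->] := beta_span x; have [d ->] := beta_span y.
by eexists; exact: (form_sum _ _ hG).
Qed.

Lemma trace_form_represents (l : K -> rat) :
  (forall c : 'I_(2 * g) -> rat, l (\sum_k c k *: beta k) = \sum_k c k * l (beta k)) ->
  exists s, forall x, l x = field_trace (s * x).
Proof.
move=> hl; pose T : 'M[rat]_(2 * g) := \matrix_(i, j) field_trace (beta i * beta j).
have tsum (c : 'I_(2 * g) -> rat) y :
    field_trace (y * \sum_k c k *: beta k) = \sum_k c k * field_trace (y * beta k).
  rewrite mulr_sumr; elim/big_rec2: _ => [|k z1 z2 _ <-].
    by rewrite -(scale0r 1) field_traceZ mul0r.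
  by rewrite field_traceD -scalerAr field_traceZ.
have tsum' (c : 'I_(2 * g) -> rat) y :
    field_trace ((\sum_k c k *: beta k) * y) = \sum_k c k * field_trace (beta k * y).
  by rewrite mulrC tsum; apply: eq_bigr => k _; rewrite [y * _]mulrC.
have hT (t : 'rV[rat]_(2 * g)) j :
    (t *m T) 0 j = field_trace ((\sum_k t 0 k *: beta k) * beta j).
  by rewrite tsum' mxE; apply: eq_bigr => k _; rewrite mxE.
have uT : T \in unitmx.
  rewrite -row_free_unit; apply: inj_row_free => t ht.
  have h0 : \sum_k t 0 k *: beta k = 0.
    apply: field_trace_nondeg => y; have [d ->] := beta_span y.
    by rewrite tsum big1 // => j _; rewrite -hT ht mxE mulr0.
  by apply/rowP => k; rewrite mxE; exact: (beta_free h0).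
pose t := (\row_j l (beta j)) *m invmx T.
exists (\sum_k t 0 k *: beta k) => x; have [d ->] := beta_span x.
rewrite hl tsum; apply: eq_bigr => j _; congr (_ * _).
by rewrite -hT mulmxKV // mxE.
Qed.

(** Moving x across by its adjoint, E(Phi x, Phi y) is the functional E(Phi 1, -) at xbar y, which
    is Tr(s xbar y). Skew symmetry puts the bar on the second argument and gives xi = -s. *)
Lemma form_trace : exists xi, bar xi = - xi /\
  forall x y, E (Phi x) (Phi y) = ratr (field_trace (xi * x * bar y)).
Proof.
have /choice [l hl] := form_rational 1.
have l_lin c : l (\sum_k c k *: beta k) = \sum_k c k * l (beta k).
  apply: (@ratr_inj R); rewrite -hl Phi_sum rmorph_sum.
  under eq_bigr do rewrite ratr_complex.
  by rewrite rform_sumr; apply: eq_bigr => k _; rewrite rmorphM hl.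
have [s hs] := trace_form_represents l_lin.
have eE x y : E (Phi x) (Phi y) = ratr (field_trace (s * (bar x * y))).
  have -> : Phi x = dg x *m Phi 1 by rewrite dg_Phi mulr1.
  by rewrite hadj dg_Phi hl hs.
have e2 x y : E (Phi x) (Phi y) = ratr (field_trace (- s * x * bar y)).
  by rewrite form_skew eE -rmorphN -field_traceN; congr (ratr (field_trace _)); ring.
exists (- s); split; last exact: e2.
apply/eqP; rewrite -subr_eq0 opprK; apply/eqP; apply: field_trace_nondeg => x.
have e : field_trace (s * bar x) = field_trace (- s * x).
  apply: (@ratr_inj R); have := eE x 1; rewrite mulr1 => <-.
  by rewrite e2 rmorph1 mulr1.
have e' : field_trace (bar s * x) = - field_trace (s * x).
  by rewrite -(field_trace_bar barK) rmorphM barK e mulNr field_traceN.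
by rewrite rmorphN mulrDl !mulNr field_traceD !field_traceN e' opprK subrr.
Qed.

Variable xi : K.
Hypothesis bar_xi : bar xi = - xi.
Hypothesis hxi : forall x y, E (Phi x) (Phi y) = ratr (field_trace (xi * x * bar y)).

(** S extends the trace form to C^g as a sum over embeddings. On the i-th standard vector w it gives
    E(w,iw) = 2 Im phi_i(xi), which is positive. *)
Lemma xi_Im i : complex.Re (phi i xi) = 0 /\ 0 < complex.Im (phi i xi).
Proof.
split.
  have := congr1 (phi i) bar_xi; rewrite phi_bar rmorphN.
  by case: (phi i xi) => a b [] /= ha; lra.
pose S (u v : V) : C := \sum_i (phi i xi * u i 0 * conjc (v i 0) +
  conjc (phi i xi * u i 0 * conjc (v i 0))).
have Sl (t : 'I_(2 * g) -> R) v :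
    S (\sum_k (t k)%:C *: Phi (beta k)) v = \sum_k (t k)%:C * S (Phi (beta k)) v.
  under [RHS]eq_bigr do rewrite mulr_sumr.
  rewrite exchange_big /=; apply: eq_bigr => j _.
  rewrite summxE mulr_sumr mulr_suml conjc_sum -big_split /=; apply: eq_bigr => k _.
  by rewrite !mxE !conjcM conjc_real; ring.
have Sr (t : 'I_(2 * g) -> R) u :
    S u (\sum_k (t k)%:C *: Phi (beta k)) = \sum_k (t k)%:C * S u (Phi (beta k)).
  under [RHS]eq_bigr do rewrite mulr_sumr.
  rewrite exchange_big /=; apply: eq_bigr => j _.
  rewrite summxE conjc_sum mulr_sumr conjc_sum -big_split /=; apply: eq_bigr => k _.
  by rewrite !mxE !conjcM !conjcK conjc_real; ring.
have ESb k l : (E (Phi (beta k)) (Phi (beta l)))%:C = S (Phi (beta k)) (Phi (beta l)).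
  rewrite hxi -ratr_complex trace_embeddings.
  by apply: eq_bigr => j _; rewrite !mxE !rmorphM phi_bar.
have ES u v : (E u v)%:C = S u v.
  have [t ->] := real_coordinates (proj1 hbeta) u.
  have [s ->] := real_coordinates (proj1 hbeta) v.
  rewrite Sl rform_suml rmorph_sum; apply: eq_bigr => k _.
  rewrite Sr rform_sumr rmorphM rmorph_sum; congr (_ * _); apply: eq_bigr => l _.
  by rewrite rmorphM; congr (_ * _); exact: ESb.
pose w : V := delta_mx i 0.
have w0 : w != 0 by apply/eqP => /colP /(_ i)/eqP; rewrite !mxE !eqxx oner_eq0.
have := form_pos B w0.
have -> : E w ('i%C *: w) = 2%:R * complex.Im (phi i xi).
  rewrite -[LHS]/(complex.Re (E w ('i%C *: w))%:C) ES /S (bigD1 i) //= big1.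
    rewrite addr0 !mxE !eqxx; case: (phi i xi) => a b /=; ring.
  by move=> j /negPf ji; rewrite !mxE ji !(mulr0, mul0r, conjc0, addr0).
by rewrite pmulr_rgt0.
Qed.

Lemma xi_neq0 : xi != 0.
Proof.
by apply/eqP => h; have [_] := xi_Im i0; rewrite h rmorph0 ltxx.
Qed.

Definition lattice_ideal : set K := [set x | lat B (Phi x)].

Lemma lattice_ideal_fractional : fractional_ideal lattice_ideal.
Proof.
have Isum (m : 'I_(2 * g) -> int) : lattice_ideal (\sum_k (m k)%:~R *: beta k).
  by apply/lat_Phi; exists m.
split.
- split; [|move=> x y /lat_Phi [m ->] /lat_Phi [n ->]|by move=> r x; exact: hO].
    have := Isum (fun=> 0); rewrite big1 // => k _; exact: scale0r.
  have := Isum (fun k => m k - n k); congr lattice_ideal.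
  by rewrite -sumrB; apply: eq_bigr => k _; rewrite rmorphB scalerBl.
- have hg : (0 < 2 * g)%N by rewrite muln_gt0 (CM_dim_gt0 dimK).
  exists (beta (Ordinal hg)); first exact: (lattice_mem_basis hbeta).
  apply/eqP => h; have := lattice_basis_neq0 hbeta (Ordinal hg); rewrite h => /eqP; apply.
  by apply/colP => i; rewrite !mxE rmorph0.
have /choice [N hN] : forall k, exists N : nat, (0 < N)%N /\ OK (N%:R * beta k).
  by move=> k; have [N N0 h] := clear_denominator (beta k); exists N.
exists (\prod_k N k)%N%:R.
  by apply: natr_ext_neq0; rewrite prodn_gt0 // => k; case: (hN k).
move=> x /lat_Phi [m ->]; rewrite mulr_sumr; apply: (subring_sum hOK) => k.
rewrite scaler_int -mulrzl mulrCA; apply: (subringM hOK); first exact: (subring_int hOK).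
rewrite (bigD1 k) //= mulnC natrM -mulrA; apply: (subringM hOK); last by case: (hN k).
exact: (subring_nat hOK).
Qed.

Lemma ratr_int_iff (q : rat) : (ratr q : R) \is a Num.int -> q \is a Num.int.
Proof.
move=> /intrP [m hm]; apply/intrP; exists m.
by apply: (@ratr_inj R); rewrite hm rmorph_int.
Qed.

Lemma lattice_ideal_int x y : lattice_ideal x -> lattice_ideal y ->
  field_trace (xi * x * bar y) \is a Num.int.
Proof. by move=> hx hy; apply: ratr_int_iff; rewrite -hxi; exact: form_int. Qed.

(** As det G = 1, the adjugate inverts the Gram matrix over the integers, so integral pairings force
    integral coordinates. *)
Lemma lattice_ideal_dual x :
  (forall y, lattice_ideal y -> field_trace (xi * x * bar y) \is a Num.int) ->
  lattice_ideal x.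
Proof.
move=> h; have [G [dG hG]] := form_basis_int.
have [c ec] := beta_span x.
have /choice [m hm] : forall l, exists m : int,
    field_trace (xi * x * bar (beta l)) = m%:~R.
  by move=> l; apply/intrP; apply: h; exact: (lattice_mem_basis hbeta).
have e1 : (\row_k c k) *m map_mx intr G = map_mx intr (\row_l m l).
  apply/rowP => l; rewrite [RHS]mxE [X in X%:~R]mxE -hm.
  apply: (@ratr_inj R); rewrite -hxi ec.
  have -> : beta l = \sum_k ((k == l)%:R : rat) *: beta k.
    rewrite (bigD1 l) //= eqxx scale1r big1 ?addr0 // => k /negPf ->.
    by rewrite scale0r.
  rewrite (form_sum _ _ hG) mxE; congr ratr; apply: eq_bigr => k _.
  rewrite !mxE (bigD1 l) //= eqxx mul1r big1 ?addr0 // => j /negPf ->.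
  by rewrite mul0r.
have e2 : \row_k c k = map_mx intr ((\row_l m l) *m \adj G).
  rewrite map_mxM -e1 -mulmxA -map_mxM mul_mx_adj dG map_scalar_mx rmorph1.
  by rewrite mulmx1.
apply/lat_Phi; exists (fun k => ((\row_l m l) *m \adj G) 0 k).
rewrite {1}ec; apply: eq_bigr => k _; congr (_ *: _).
by have := congr1 (fun M : 'rV_(2 * g) => M 0 k) e2; rewrite mxE => ->; rewrite mxE.
Qed.

(** O_K acts on the lattice by integer matrices; with n/N integral, x is coloured by its matrix
    modulo n. If the colours of x and y agree, (x - y)/n acts by an integer matrix, so it is
    integral, and so is its multiple (x - y)/N. *)
Lemma ring_of_integers_finite : finite_quotients OK.
Proof.
move=> N ON N0; have [n n0 hn] := clear_denominator N^-1.
have nK : (n%:R : K) != 0 := natr_ext_neq0 K n0.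
have /choice [m hm] : forall x, exists m : 'I_(2 * g) * 'I_(2 * g) -> int,
    OK x -> forall j, x * beta j = \sum_k (m (j, k))%:~R *: beta k.
  move=> x; have [hx|nx] := pselect (OK x); last by exists (fun=> 0).
  have /choice [a ha] : forall j, exists a : 'I_(2 * g) -> int,
      x * beta j = \sum_k (a k)%:~R *: beta k.
    by move=> j; apply/lat_Phi; apply: hO => //; exact: (lattice_mem_basis hbeta).
  by exists (fun p => a p.1 p.2).
(* As n > 0, n.-1.+1 is n, in the successor form that [inord] requires. *)
exists {ffun 'I_(2 * g) * 'I_(2 * g) -> 'I_n.-1.+1},
  (fun x => [ffun p => inord `|(m x p %% n%:Z)%Z|%N]).
move=> x y hx hy /ffunP e.
have n0z : n%:Z != 0 by rewrite -lt0n in n0 *.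
have emod p : (n%:Z %| m x p - m y p)%Z.
  have := congr1 val (e p); rewrite !ffunE /= !inordK; last first.
  - rewrite prednK // -ltz_nat gez0_abs ?modz_ge0 //; exact: ltz_pmod.
  - rewrite prednK // -ltz_nat gez0_abs ?modz_ge0 //; exact: ltz_pmod.
  move=> /(congr1 Posz); rewrite !gez0_abs ?modz_ge0 // => h.
  by rewrite -eqz_mod_dvd; apply/eqP.
have OKn : OK (n%:R^-1 * (x - y)).
  pose q p := ((m x p - m y p) %/ n%:Z)%Z.
  apply: (@integral_of_int_matrix _ _ (\matrix_(j, k) q (j, k)) beta).
    have hg : (0 < 2 * g)%N by rewrite muln_gt0 (CM_dim_gt0 dimK).
    exists (Ordinal hg); apply/eqP => h.
    have := lattice_basis_neq0 hbeta (Ordinal hg); rewrite h => /eqP; apply.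
    by apply/colP => i; rewrite !mxE rmorph0.
  move=> j; rewrite -mulrA mulrBl (hm x hx) (hm y hy) -sumrB mulr_sumr.
  apply: eq_bigr => k _; rewrite mxE -scalerBl -rmorphB.
  rewrite -[in LHS](divzK (emod (j, k))) -/(q (j, k)) scaler_int -mulrzl rmorphM mulrA.
  by rewrite mulrCA mulVf ?mulr1.
have -> : N^-1 * (x - y) = (n%:R * N^-1) * (n%:R^-1 * (x - y)).
  by rewrite mulrACA divff // mul1r.
exact: (subringM hOK).
Qed.

End TraceForm.

(** * Normalizing the coordinates and the ideal *)

(** No coordinate of M v0 vanishes, since the i-th coordinate would then vanish on all M b_j, which
    span C^g over the reals. A diagonal matrix, which commutes with the diagonalized action, makes
    every coordinate 1. *)
Lemma standard_coordinates (R : realType) (g : nat) (K : fieldExtType rat)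
    (J : {rmorphism K -> 'M[R[i]]_g}) (Lam : set 'cV[R[i]]_g)
    (b : 'I_(2 * g) -> 'cV[R[i]]_g) (v0 : 'cV[R[i]]_g) (beta : 'I_(2 * g) -> K) :
  (0 < g)%N -> lattice_basis b Lam -> (forall j, J (beta j) *m v0 = b j) ->
  exists (M : 'M[R[i]]_g) (phi : 'I_g -> {rmorphism K -> R[i]}),
    [/\ M \in unitmx, forall x, M *m J x = diag_mx (\row_i phi i x) *m M
      & forall j, M *m b j = Phi_vec (fun i => phi i : K -> R[i]) (beta j)].
Proof.
move=> g0 hb hbeta; have [M [phi [uM hM]]] := diagonalize_representation J g0.
pose w := M *m v0.
have Mb j i : (M *m b j) i 0 = phi i (beta j) * w i 0.
  by rewrite -hbeta mulmxA hM -mulmxA mul_diag_mx !mxE.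
have w0 i : w i 0 != 0.
  apply/eqP => wi; have [t ht] := real_coordinates (proj1 hb) (invmx M *m delta_mx i 0).
  have := congr1 (fun v => (M *m v) i 0) ht.
  rewrite mulKVmx // mulmx_sumr summxE big1 => [|j _]; last first.
    by rewrite -scalemxAr mxE Mb wi !mulr0.
  by rewrite mxE !eqxx => /eqP; rewrite oner_eq0.
pose D := diag_mx (\row_i (w i 0)^-1).
have uD : D \in unitmx.
  rewrite unitmxE det_diag unitfE; apply/prodf_neq0 => i _.
  by rewrite mxE invr_eq0.
exists (D *m M), phi; split; first by rewrite unitmx_mul uD.
  by move=> x; rewrite -mulmxA hM !mulmxA diag_mxC.
move=> j; apply/colP => i.
by rewrite -mulmxA mul_diag_mx [LHS]mxE [X in X * _]mxE Mb mulrCA mulVf // mulr1 mxE.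
Qed.

Section Rescale.
Variables (R : realType) (g : nat) (K : fieldExtType rat).
Variables (bar : {rmorphism K -> K}) (I : set K) (xi y : K).
Hypothesis barK : forall x, bar (bar x) = x.
Hypothesis y0 : y != 0.
(** This is y^-1 I; multiplication by y carries its trace form for xi' to that of I for xi. *)
Let I' : set K := [set w | I (y * w)].
Let xi' := xi * y * bar y.

Lemma rescale_fractional : fractional_ideal I -> fractional_ideal I'.
Proof.
case=> -[h0 hB hM] [x hx x0] [d d0 hd]; split.
- split; first by rewrite /I' /= mulr0.
    by move=> u v hu hv; rewrite /I' /= mulrBr; exact: hB.
  by move=> r u hr hu; rewrite /I' /= mulrCA; exact: hM.
- by exists (y^-1 * x); [rewrite /I' /= mulVKf|rewrite mulf_neq0 ?invr_eq0].
exists (d * y); first by rewrite mulf_neq0.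
by move=> u hu; rewrite -mulrA; exact: hd.
Qed.

Lemma rescale_neq0 : xi != 0 -> xi' != 0.
Proof. by move=> h; rewrite !mulf_neq0 ?fmorph_eq0. Qed.

Lemma rescale_int :
  (forall u v, I u -> I v -> field_trace (xi * u * bar v) \is a Num.int) ->
  forall u v, I' u -> I' v -> field_trace (xi' * u * bar v) \is a Num.int.
Proof.
move=> h u v hu hv; have := h _ _ hu hv; rewrite rmorphM /xi'.
by congr (field_trace _ \is a Num.int); ring.
Qed.

Lemma rescale_dual :
  (forall u, (forall v, I v -> field_trace (xi * u * bar v) \is a Num.int) -> I u) ->
  forall u, (forall v, I' v -> field_trace (xi' * u * bar v) \is a Num.int) -> I' u.
Proof.
move=> h u hu; apply: h => v hv; have := hu (y^-1 * v).
rewrite /I' /= mulVKf // => /(_ hv); rewrite rmorphM fmorphV /xi'.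
congr (field_trace _ \is a Num.int); field.
by rewrite fmorph_eq0.
Qed.

End Rescale.

(** * The choice of z and the isomorphism *)

Unset Implicit Arguments.

Theorem theorem7p3 (R : realType) (g : nat) (K : fieldExtType rat)
    (K0 : {subfield K}) (hK : CM_field R g K0)
    (delta : subvs_of K0)
    (hdelta : different (subvs_of K0) = @principal_ideal (subvs_of K0) delta)
    (A : polAV R g) (hA : principally_polarized A)
    (iota : K -> 'M[R[i]]_g) (hiota : CM_embedding A iota)
    (hpol : simple_AV A \/ rosati_stable A iota) :
  exists z : K,
    let a : set K := [set w | exists x y : subvs_of K0,
      [/\ ring_of_integers (subvs_of K0) x, ring_of_integers (subvs_of K0) y
        & w = z * vsval x + vsval y]] in
    let xi : K := (z - cmconj R z)^-1 * (vsval delta)^-1 in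
    let Phi : set (K -> R[i]) :=
      [set f | embeddings R K f /\ 0 < complex.Im (f xi)] in
    [/\ OL_submodule a, CM_triple g Phi a xi
      & exists2 B : polAV R g, is_A_Phi_a_xi Phi a xi B & polAV_iso A B].
Proof.
have dimK : \dim {:K} = (2 * g)%N := CM_dim hK.
have g0 : (0 < g)%N := CM_dim_gt0 dimK.
have [b hb hdetA] := hA.
have [J hJ] := extend_embedding hiota.
have J_lattice r v : ring_of_integers K r -> lat A v -> lat A (J r *m v).
  by move=> hr hv; rewrite hJ //; case: hiota => h _ _ _ _; exact: h.
have hrosA x : exists y, forall u v, rform A (J x *m u) v = rform A u (J y *m v).
  case: hpol => h; first exact: (simple_adjoint dimK hb J_lattice).
  exact: (stable_adjoint x hJ h).
have gg : (0 < 2 * g)%N by rewrite muln_gt0.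
have [beta hbeta0] := cyclic_basis dimK hb J_lattice
  (lattice_mem_basis hb (Ordinal gg)) (lattice_basis_neq0 hb (Ordinal gg)).
have [M [phi [uM hM Mb]]] := standard_coordinates g0 hb hbeta0.
pose Ph := Phi_vec (fun i => phi i : K -> R[i]).
have {}Mb j : M *m b j = Ph (beta j) := Mb j.
have [B [latB formB]] := polAV_transport A uM.
have hbeta : lattice_basis (fun j => Ph (beta j)) (lat B).
  rewrite latB (_ : (fun j => Ph (beta j)) = (fun j => M *m b j)).
    exact: lattice_basis_image.
  by apply/funext => j; rewrite Mb.
have hdet : \det (\matrix_(i, j) rform B (Ph (beta i)) (Ph (beta j))) = 1.
  by rewrite -hdetA; congr (\det _); apply/matrixP => i j; rewrite !mxE -!Mb formB.
have hros x : exists y, forall u v, rform B (diag_mx (\row_i phi i x) *m u) v =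
    rform B u (diag_mx (\row_i phi i y) *m v).
  have [y hy] := hrosA x; exists y => u v.
  by rewrite -(mulKVmx uM u) -(mulKVmx uM v) !mulmxA -!hM -!mulmxA !formB hy.
have hO r x : ring_of_integers K r -> lat B (Ph x) -> lat B (Ph (r * x)).
  rewrite latB => hr [v hv e]; exists (J r *m v); first exact: J_lattice.
  by rewrite mulmxA hM -mulmxA e dg_Phi.
have [bar hbar] := cm_conjugation hK hbeta hros.
have barE := embedding_bar hK hbeta hros hbar.
have barK := cm_barK hK hbeta hros hbar.
have bar_fixed := cm_bar_fixed hK hbeta hros hbar.
have bar_nontrivial := cm_bar_nontrivial hK hbeta hros hbar.
have hadj := adjoint_bar hK hbeta hros hbar.
have phi_bar i x : phi i (bar x) = conjc (phi i x) by exact: barE.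
have [xi [bar_xi hxi]] := form_trace dimK hbeta hdet barK hadj.
have xiIm := xi_Im dimK hbeta phi_bar bar_xi hxi.
have xi0 := xi_neq0 dimK hbeta phi_bar bar_xi hxi.
have OKfin := ring_of_integers_finite dimK hbeta hO.
have I_ideal := lattice_ideal_fractional dimK hbeta hO.
have I_int := lattice_ideal_int hxi.
have I_dual := lattice_ideal_dual dimK hbeta hdet hxi.
have [x [y [hx hy e1 hI]]] := ideal_free barK bar_fixed bar_nontrivial OKfin
  I_ideal xi0 bar_xi I_int I_dual hdelta.
set I := lattice_ideal phi B in I_ideal I_int I_dual hx hy hI.
have [dl0 _] := C0_principal barK bar_fixed bar_nontrivial OKfin
  I_ideal xi0 bar_xi I_int I_dual hdelta.
have y0 : y != 0.
  by apply/eqP => h; move/eqP: e1; rewrite h rmorph0 !mulr0 subrr mulr0 eq_sym oner_eq0.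
have by0 : bar y != 0 by rewrite fmorph_eq0.
(* Dividing the basis x, y of I by y gives z, 1. *)
pose z := x / y; exists z => /=.
set a := [set w | _]; set xi' := _ * _; set Phi := [set f | _].
(* This is B(x,y) = 1 with y ybar factored out: delta xi y ybar (z - zbar) = 1. *)
have hxi' : xi' = xi * y * bar y.
  have d0 : x * bar y - bar x * y != 0.
    by apply/eqP => h; move/eqP: e1; rewrite h mulr0 eq_sym oner_eq0.
  have ez : z - cmconj R z = (x * bar y - bar x * y) / (y * bar y).
    by rewrite -hbar /z rmorphM fmorphV; field; rewrite by0 y0.
  have exi : xi = vsval delta * xi * (x * bar y - bar x * y) /
      (vsval delta * (x * bar y - bar x * y)) by field; rewrite d0 dl0.
  by rewrite /xi' ez exi e1; field; rewrite dl0 d0 y0 by0.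
have ha : a = [set w | I (y * w)].
  apply/seteqP; split=> w /=.
    case=> p [q [hp hq ->]]; apply/hI; exists (vsval p), (vsval q).
    split; [split; [exact/OL_subvs|by apply/bar_fixed; exists p]| |].
      by split; [exact/OL_subvs|by apply/bar_fixed; exists q].
    by rewrite /z; field.
  move/hI => [p [q [[hp /bar_fixed [p' ep]] [hq /bar_fixed [q' eq]] e]]].
  exists p', q'; split; try by apply/OL_subvs; rewrite -?ep -?eq.
  by apply: (mulfI y0); rewrite e -ep -eq /z; field.
have fa : fractional_ideal a by rewrite ha; exact: rescale_fractional.
(* phi_i(xi') is phi_i(xi) times the positive real number |phi_i(y)|^2. *)
have fx_Im i : complex.Re (phi i xi') = 0 /\ 0 < complex.Im (phi i xi').
  have y1 : phi i y != 0 by rewrite fmorph_eq0.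
  have [] := xiIm i; rewrite hxi' !rmorphM phi_bar -mulrA; move: y1.
  case: (phi i xi) (phi i y) => p q [s t] /= st -> hq; split; first by ring.
  have h : 0 < s ^+ 2 + t ^+ 2.
    rewrite lt_neqAle addr_ge0 ?sqr_ge0 // andbT eq_sym paddr_eq0 ?sqr_ge0 //.
    by rewrite !sqrf_eq0; apply: contra st => /andP [/eqP -> /eqP ->].
  have -> : 0 * (s * - t + t * s) + q * (s * s - t * - t) = q * (s ^+ 2 + t ^+ 2) by ring.
  exact: mulr_gt0.
(* Every other embedding is the conjugate of some phi_i, and its value at xi' has negative imaginary
   part. *)
have PhiP f : Phi f <-> exists i, f = phi i.
  split=> [[[psi ->] him]|[i ->]]; last by split; [exists (phi i)|case: (fx_Im i)].
  have [i [h|h]] := phi_conj_exhaust hK hbeta psi; first by exists i; apply/funext.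
  move: him; rewrite h; have [_] := fx_Im i; case: (phi i xi') => p q /= h1.
  by rewrite oppr_gt0 => /(lt_trans h1); rewrite ltxx.
have bij : set_bij setT Phi (fun i => phi i : K -> R[i]).
  split.
  - by move=> i _; apply/PhiP; exists i.
  - move=> i j _ _ e; apply/eqP/negPn/negP => ij; apply: (phi_separated hbeta ij).
    by move=> u; rewrite e.
  - by move=> f /PhiP [i ->]; exists i.
split; first by case: fa.
  split.
  - split.
      have -> : Phi = [set (phi i : K -> R[i]) | i in [set: 'I_g]].
        by apply/seteqP; split=> [f /PhiP [i ->]|_ [i _ <-]]; [exists i|apply/PhiP; exists i].
      by apply: inj_card_eq; case: bij.
    apply/seteqP; split=> [f [[]//|[_ /PhiP [i ->] <-]]|_ [psi ->]].
      by exists ((conjc : R[i] -> R[i]) \o phi i).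
    have [i [h|h]] := phi_conj_exhaust hK hbeta psi.
      by left; apply/PhiP; exists i; apply/funext.
    by right; exists (phi i); [apply/PhiP; exists i|apply/funext => u; rewrite h].
  - exact: fa.
  - rewrite (_ : @cmconj R K = bar :> (K -> K)); last by apply/funext => u; rewrite hbar.
    rewrite hxi'; apply: (inverse_polarization_ideal barK OKfin fa).
    + exact: rescale_neq0.
    + by rewrite ha; exact: rescale_int.
    + by rewrite ha; exact: rescale_dual.
  - by move=> f /PhiP [i ->]; exact: fx_Im.
(* Division by y, in the coordinates given by the phi_i. *)
pose N := diag_mx (\row_i (phi i y)^-1).
have uN : N \in unitmx.
  rewrite unitmxE det_diag unitfE; apply/prodf_neq0 => i _.
  by rewrite mxE invr_eq0 fmorph_eq0.
have NPh u : N *m Ph (y * u) = Ph u.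
  apply/colP => i; rewrite mul_diag_mx !mxE rmorphM mulKf //.
  by rewrite fmorph_eq0.
have uNM : N *m M \in unitmx by rewrite unitmx_mul uN.
have [B' [latB' formB']] := polAV_transport A uNM.
have formB'' u v : rform B' (N *m u) (N *m v) = rform B u v.
  rewrite -{1}(mulKVmx uM u) -{1}(mulKVmx uM v) !(mulmxA N) formB'.
  by rewrite -formB !mulKVmx.
exists B'; last by exists (N *m M).
exists (fun i => phi i : K -> R[i]); split=> //; last first.
  move=> u v; rewrite -[Phi_vec _ u]NPh -[Phi_vec _ v]NPh formB'' hxi hxi' -hbar.
  by rewrite rmorphM; congr (ratr (field_trace _)); ring.
rewrite latB'; apply/seteqP; split=> [_ [v hv <-]|_ [u hu <-]].
  have : lat B (M *m v) by rewrite latB; exists v.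
  case: (hbeta) => _ -> [m hm]; exists (y^-1 * \sum_k (m k)%:~R *: beta k).
    rewrite ha /= mulVKf //; apply/(lat_Phi dimK hbeta); first by exists m.
  rewrite -mulmxA hm -[LHS]NPh mulVKf //; congr (_ *m _).
  by rewrite /Ph Phi_sum; apply: eq_bigr => k _; rewrite rmorph_int.
move: hu; rewrite ha /= /I /lattice_ideal /= latB => -[v hv e].
by exists v => //; rewrite -mulmxA e NPh.
Qed.
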